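(* Let $c:[0,l]\to\mathbb{R}^3$ be a closed regular smooth curve parametrized by arc length $u$, with nowhere vanishing curvature, and let $\tau(u)$ be its torsion. Then $c$ is a curve of umbilic points of a regular smooth oriented surface containing $c$ if and only if $$\int_0^l\tau(u)\,du\in 2\pi\mathbb{Z}.$$
   Context: The torsion $\tau$ and curvature $\kappa$ of $c$ are those of its Frenet frame $\{t,n,b\}$: $t'=\kappa n$, $n'=-\kappa t+\tau b$, $b'=-\tau n$. A curve of umbilic points of a surface is a curve contained in the surface at each point of which the two principal curvatures of the surface coincide. Surfaces in $\mathbb{R}^3$ are oriented by a globally given unit normal vector field $N$. *)

(* Defs.v *)
From HB Require Import structures.
From mathcomp Require Import all_boot all_order all_algebra.
From mathcomp Require Import all_classical all_reals all_analysis.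

Set Implicit Arguments.
Unset Strict Implicit.
Unset Printing Implicit Defensive.

Import Order.TTheory GRing.Theory Num.Theory.
Import numFieldNormedType.Exports.

Local Open Scope classical_set_scope.
Local Open Scope ring_scope.

(* The library norm `|v| on 'rV[R]_3 is the sup norm, hence [enorm]. *)
Definition dotv (R : realType) (u v : 'rV[R]_3) : R :=
  \sum_(i < 3) u 0 i * v 0 i.

Definition enorm (R : realType) (v : 'rV[R]_3) : R := Num.sqrt (dotv v v).

(* Indices are taken modulo 3. *)
Definition crossv (R : realType) (u v : 'rV[R]_3) : 'rV[R]_3 :=
  \row_(i < 3) (u 0 (i + 1) * v 0 (i + 2%:R) - u 0 (i + 2%:R) * v 0 (i + 1)).

Fixpoint Ck_on (R : realType) (V W : normedModType R) (k : nat)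
    (U : set V) (f : V -> W) : Prop :=
  if k is k'.+1 then
    (forall q, U q -> differentiable f q) /\
    (forall v, Ck_on k' U (fun q => 'D_v f q))
  else forall q, U q -> {for q, continuous f}.

Definition smooth_on (R : realType) (V W : normedModType R)
    (U : set V) (f : V -> W) : Prop := forall k, Ck_on k U f.

(* A closed smooth curve [0, l] -> R^3 is represented by its l-periodic smooth
   extension to R: the derivatives of all orders agree at 0 and l. *)
Definition closed_smooth_curve (R : realType) (l : R) (c : R -> 'rV[R]_3) :
    Prop :=
  (forall k u, derivable (c^`(k))%classic u 1) /\ (forall u, c (u + l) = c u).

Definition simple_curve (R : realType) (l : R) (c : R -> 'rV[R]_3) : Prop :=
  forall u v, 0 <= u < l -> 0 <= v < l -> c u = c v -> u = v.

Definition arc_length_parametrized (R : realType) (c : R -> 'rV[R]_3) : Prop :=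
  forall u, enorm ((c^`())%classic u) = 1.

Definition tangent (R : realType) (c : R -> 'rV[R]_3) : R -> 'rV[R]_3 :=
  (c^`())%classic.

Definition curvature (R : realType) (c : R -> 'rV[R]_3) (u : R) : R :=
  enorm ((tangent c)^`()%classic u).

Definition principal_normal (R : realType) (c : R -> 'rV[R]_3) (u : R) :
    'rV[R]_3 :=
  (curvature c u)^-1 *: (tangent c)^`()%classic u.

Definition binormal (R : realType) (c : R -> 'rV[R]_3) (u : R) : 'rV[R]_3 :=
  crossv (tangent c u) (principal_normal c u).

(* The b-component of n' = - kappa t + tau b. *)
Definition torsion (R : realType) (c : R -> 'rV[R]_3) (u : R) : R :=
  dotv ((principal_normal c)^`()%classic u) (binormal c u).

(* x : U -> x(U) is a homeomorphism between open sets (of R^2 and of M) such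
   that f \o x is a smooth immersion on U and N \o x is a smooth unit normal
   field along it. The rows of 'J g q are the partial derivatives of g at q. *)
Definition local_parametrization (R : realType) (M : topologicalType)
    (f N : M -> 'rV[R]_3) (U : set 'rV[R]_2) (x : 'rV[R]_2 -> M) : Prop :=
  [/\ [/\ open U,
          forall q, U q -> {for q, continuous x},
          forall p q, U p -> U q -> x p = x q -> p = q &
          forall V, open V -> V `<=` U -> open (x @` V)],
      smooth_on U (f \o x),
      forall q, U q -> row_free ('J (f \o x) q),
      smooth_on U (N \o x) &
      forall q, U q ->
        enorm (N (x q)) = 1 /\ 'J (f \o x) q *m (N (x q))^T = 0].

(* A smooth oriented surface in R^3: a topological surface M immersed by f, with
   a unit normal field N on all of M. The smooth structure on M is the
   one induced by f: two local parametrizations differ by a smooth change of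
   coordinates, since f is locally an embedding. *)
Record oriented_surface (R : realType) := OrientedSurface {
  surface_space :> topologicalType;
  immersion : surface_space -> 'rV[R]_3;
  unit_normal : surface_space -> 'rV[R]_3;
  surface_hausdorff : hausdorff_space surface_space;
  surface_second_countable : @second_countable surface_space;
  surface_parametrized : forall p : surface_space, exists U x,
    local_parametrization immersion unit_normal U x /\ (x @` U) p
}.

(* The immersion is a homeomorphism onto its image, which is then an embedded
   regular surface of R^3. *)
Definition embedded (R : realType) (S : oriented_surface R) : Prop :=
  injective (@immersion R S) /\
  forall A : set S, open A ->
    exists2 B : set 'rV[R]_3, open B & A = @immersion R S @^-1` B.

(* k1 and k2 are the eigenvalues, with multiplicity, of the shape operator -dN
   on the tangent plane at p. In the basis of the partial derivatives of f \o x,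
   the shape operator is the matrix A, acting on row vectors, with
   - dN(w) = df(w A) for w in R^2. *)
Definition principal_curvatures (R : realType) (S : oriented_surface R) (p : S)
    (k1 k2 : R) : Prop :=
  exists U x q (A : 'M[R]_2),
    [/\ local_parametrization (@immersion R S) (@unit_normal R S) U x,
        U q, x q = p,
        - 'J (@unit_normal R S \o x) q = A *m 'J (@immersion R S \o x) q &
        char_poly A = ('X - k1%:P) * ('X - k2%:P)].

Definition umbilic (R : realType) (S : oriented_surface R) (p : S) : Prop :=
  exists k1 k2, principal_curvatures p k1 k2 /\ k1 = k2.

(* S contains the closed curve c: c is the image of a closed continuous curve g
   of S (for an embedded S, this says that the image of c lies in that of S);
   the points of g are umbilic. *)
Definition curve_of_umbilic_points (R : realType) (S : oriented_surface R)
    (l : R) (c : R -> 'rV[R]_3) : Prop :=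
  exists g : R -> S,
    [/\ continuous g, forall u, g (u + l) = g u,
        forall u, immersion (g u) = c u & forall u, umbilic (g u)].

(* Main.v *)
Require Import Defs.
From HB Require Import structures.
From mathcomp Require Import all_boot all_order all_algebra.
From mathcomp Require Import all_classical all_reals all_analysis.
From mathcomp Require Import ring lra.

Import Order.TTheory GRing.Theory Num.Theory.
Import numFieldNormedType.Exports.

Local Open Scope classical_set_scope.
Local Open Scope ring_scope.

Set Implicit Arguments.
Unset Strict Implicit.
Unset Printing Implicit Defensive.

(** Write [t, n, b] for the Frenet frame of [c] and let [nu] be the restriction
    to [c] of the unit normal of an oriented surface containing [c]. If the
    points of [c] are umbilic then [nu' = - lam t] for some function [lam]: the
    field [nu] does not rotate about [c]. Every smooth unit normal field of [c]
    with this property is in turn realized by a surface with umbilic points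
    along [c], so the question is whether [c] has a periodic one.

    Such a field rotates with respect to the Frenet frame at speed [- tau]: the
    components [x = nu . n] and [y = nu . b] satisfy [x' = tau y] and
    [y' = - tau x]. The field and the frame both return to their initial
    position after one turn, so the total angle, which is the total torsion up
    to sign, is a multiple of [2 pi] ([parallel_normal_total_torsion]).

    That [nu' = - lam t] along a curve of umbilic points
    ([umbilic_normal_derive]) is the definition of an umbilic point once the
    shape operator is known to be scalar there. A double root of the
    characteristic polynomial gives this only because the shape operator is
    self-adjoint ([selfadjoint_scalar]), which comes from the symmetry of second
    derivatives ([derive_sym]). The curve is only assumed to lift continuously
    to the surface; it lifts at the needed rate because an immersion expands
    distances up to a constant ([param_curve_derive0]).

    Conversely, if the total torsion is a multiple of [2 pi], the Frenet normals
    turned back by an antiderivative of the torsion close up to a periodic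
    frame [t, w, nu] without rotation, with [w' = - mu t] and [nu' = - lam t]
    ([exists_parallel_framing]). The surface swept by
    [c + v w + (lam v ^ 2 / 2) nu] has, along [v = 0], the normal [nu] and a
    second fundamental form equal to [lam] times the first one
    ([is_derive_surf_normal_axis]). By compactness it is immersed for small
    [|v|] ([strip_surf_alpha]), and injective there modulo the period when [c]
    is simple ([strip_surf_injective]). Its domain is a cylinder, on which the
    coordinates [(u, v)] provide the charts; again by compactness, the open
    subsets of the cylinder are cut out by open sets of the ambient space
    ([saturated_open]), which makes an injective surface embedded. *)

(** * Vector algebra in three-space *)

Section vector_algebra.
Context {R : realType}.
Implicit Types (u v w : 'rV[R]_3) (a b : R).

Lemma dotvE u v : dotv u v = u 0 0 * v 0 0 + u 0 1 * v 0 1 + u 0 2%:R * v 0 2%:R.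
Proof.
rewrite /dotv !big_ord_recl big_ord0 addr0 addrA.
by congr (_ + _ * _ + _ * _); congr (_ 0 _); apply/val_inj.
Qed.

Lemma ord3P (P : 'I_3 -> Prop) : P 0 -> P 1 -> P 2%:R -> forall i, P i.
Proof.
move=> P0 P1 P2 [[|[|[|//]]] i3].
- by have -> : Ordinal i3 = 0 by exact/val_inj.
- by have -> : Ordinal i3 = 1 by exact/val_inj.
- by have -> : Ordinal i3 = 2%:R by exact/val_inj.
Qed.

Lemma row3P u v :
  u 0 0 = v 0 0 -> u 0 1 = v 0 1 -> u 0 2%:R = v 0 2%:R -> u = v.
Proof. by move=> ? ? ?; apply/rowP; exact: ord3P. Qed.

Lemma crossvE u v :
  ((crossv u v 0 0 = u 0 1 * v 0 2%:R - u 0 2%:R * v 0 1) *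
   (crossv u v 0 1 = u 0 2%:R * v 0 0 - u 0 0 * v 0 2%:R) *
   (crossv u v 0 2%:R = u 0 0 * v 0 1 - u 0 1 * v 0 0))%type.
Proof.
do !split; rewrite !mxE; by do ![congr (_ - _)|congr (_ * _)|congr (_ 0 _)|apply/val_inj].
Qed.

Lemma dotvC u v : dotv u v = dotv v u.
Proof. by rewrite !dotvE; ring. Qed.

Lemma dotvDl u v w : dotv (u + v) w = dotv u w + dotv v w.
Proof. by rewrite !dotvE !mxE; ring. Qed.

Lemma dotvDr u v w : dotv w (u + v) = dotv w u + dotv w v.
Proof. by rewrite !dotvE !mxE; ring. Qed.

Lemma dotvZl a u w : dotv (a *: u) w = a * dotv u w.
Proof. by rewrite !dotvE !mxE; ring. Qed.

Lemma dotvZr a u w : dotv w (a *: u) = a * dotv w u.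
Proof. by rewrite !dotvE !mxE; ring. Qed.

Lemma dotvNl u w : dotv (- u) w = - dotv u w.
Proof. by rewrite !dotvE !mxE; ring. Qed.

Lemma dotvNr u w : dotv w (- u) = - dotv w u.
Proof. by rewrite !dotvE !mxE; ring. Qed.

Lemma dot0v w : dotv 0 w = 0.
Proof. by rewrite !dotvE !mxE; ring. Qed.

Lemma dotv0 w : dotv w 0 = 0.
Proof. by rewrite !dotvE !mxE; ring. Qed.

Definition dotv_lin :=
  (dotvDl, dotvDr, dotvZl, dotvZr, dotvNl, dotvNr, dot0v, dotv0).

Lemma dotv_ge0 u : 0 <= dotv u u.
Proof. by rewrite dotvE !addr_ge0// -expr2 sqr_ge0. Qed.

Lemma dotv_eq0 u : (dotv u u == 0) = (u == 0).
Proof.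
apply/eqP/eqP => [|->]; last by rewrite dotv_lin.
rewrite dotvE => u0.
by apply: row3P; rewrite mxE; move: u0; nra.
Qed.

Lemma sqr_enorm u : enorm u ^+ 2 = dotv u u.
Proof. by rewrite sqr_sqrtr// dotv_ge0. Qed.

Lemma enorm1 u : enorm u = 1 <-> dotv u u = 1.
Proof.
split=> [u1|]; first by rewrite -sqr_enorm u1 expr1n.
by rewrite /enorm => ->; rewrite sqrtr1.
Qed.

Lemma mulmx_trE u v : u *m v^T = (dotv u v)%:M.
Proof.
apply/matrixP => i j; rewrite !ord1 !mxE eqxx mulr1n.
by rewrite /dotv; apply: eq_bigr => k _; rewrite mxE.
Qed.

Lemma dotv_crossl u v : dotv u (crossv u v) = 0.
Proof. by rewrite dotvE !crossvE; ring. Qed.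

Lemma dotv_crossr u v : dotv v (crossv u v) = 0.
Proof. by rewrite dotvE !crossvE; ring. Qed.

Lemma crossv_lagrange u v :
  dotv (crossv u v) (crossv u v) = dotv u u * dotv v v - dotv u v ^+ 2.
Proof. by rewrite !dotvE !crossvE; ring. Qed.

Lemma crossvA u v w : crossv u (crossv v w) = dotv u w *: v - dotv u v *: w.
Proof. by apply: row3P; rewrite !(crossvE, mxE) !dotvE; ring. Qed.

Definition orthonormal3 u v w :=
  [/\ dotv u u = 1, dotv v v = 1, dotv w w = 1,
      dotv u v = 0 & dotv u w = 0 /\ dotv v w = 0].

Lemma orthonormal_cross u v :
  dotv u u = 1 -> dotv v v = 1 -> dotv u v = 0 -> orthonormal3 u v (crossv u v).
Proof.
move=> uu vv uv; split=> //; last by rewrite dotv_crossl dotv_crossr.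
by rewrite crossv_lagrange uu vv uv; ring.
Qed.

(** The matrix with rows [u], [v], [w] is orthogonal, so its transpose is a
    two-sided inverse. *)
Lemma orthonormal_expand u v w x : orthonormal3 u v w ->
  x = dotv x u *: u + dotv x v *: v + dotv x w *: w.
Proof.
move=> [uu vv ww uv [uw vw]].
pose r (i : 'I_3) := if i == 0 then u else if i == 1 then v else w.
pose P : 'M[R]_3 := \matrix_i r i.
have PPT : P *m P^T = 1%:M.
  apply/matrixP => i j; rewrite !mxE.
  rewrite (_ : \sum_k _ = dotv (r i) (r j)); last first.
    by apply: eq_bigr => k _; rewrite !mxE.
  elim/ord3P: i; elim/ord3P: j; rewrite /r ?eqxx//= ?(dotvC v u) ?(dotvC w) //.
have /esym := mulmxA x P^T P; rewrite (mulmx1C PPT) mulmx1 => {1}<-.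
have -> : x *m P^T = \row_i dotv x (r i).
  by apply/rowP => i; rewrite !mxE; apply: eq_bigr => k _; rewrite !mxE.
apply/rowP => j; rewrite !mxE -[LHS]/(\sum_(k < 3) _).
transitivity (dotv (\row_i dotv x (r i)) (\row_i r i 0 j)).
  by apply: eq_bigr => k _; rewrite !mxE.
by rewrite dotvE !mxE.
Qed.

Lemma orthonormal_sqr u v w x : orthonormal3 u v w ->
  dotv x x = dotv x u ^+ 2 + dotv x v ^+ 2 + dotv x w ^+ 2.
Proof.
move=> /orthonormal_expand h; rewrite {2}(h x) 2!dotvDr !dotvZr.
by rewrite !expr2.
Qed.

End vector_algebra.

(** * Derivatives of vector-valued maps *)

Lemma differentiable_near (R : numFieldType) (V W : normedModType R)
    (f g : V -> W) (x : V) :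
  {near x, f =1 g} -> differentiable f x -> differentiable g x.
Proof.
move=> fg /diff_locallyP[fc /eqaddoP fo].
have go : g \o shift x = cst (g x) + 'd f x +o_ 0 id.
  apply/eqaddoP => e e0; have := fo _ e0.
  have fg0 : \forall h \near (0 : V), f (h + x) = g (h + x).
    by move: fg; rewrite [X in X -> _](near_shift 0 x) subr0.
  by apply: filterS2 fg0 => h; rewrite !fctE /= (nbhs_singleton fg) => ->.
by apply/diff_locallyP; rewrite (diff_unique fc go).
Qed.

(** The first-order expansion, with the remainder in epsilon form. *)
Lemma differentiable_approx (R : numFieldType) (V W : normedModType R)
    (f : V -> W) (x : V) :
  differentiable f x -> forall e, 0 < e ->
  \forall y \near x, `|f y - f x - 'd f x (y - x)| <= e * `|y - x|.
Proof.
move=> /diff_locallyP[_ /eqaddoP fo] e e0; have := fo _ e0.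
rewrite [X in _ -> X](near_shift 0 x) /= subr0.
apply: filterS => h; rewrite !fctE /= addrK.
by rewrite opprD addrA.
Qed.

Section is_derive_row.
Context {R : realFieldType} {V : normedModType R}.

Lemma is_derive_rowP n (f : V -> 'rV[R]_n) (df : 'rV[R]_n) (p v : V) :
  is_derive p v f df <->
  forall i, is_derive p v (fun q => f q 0 i) (df 0 i).
Proof.
split=> [[fd <-] i|fi].
  apply: DeriveDef; first by move/derivable_mxP : fd; exact.
  by rewrite derive_mx// mxE.
have fd : derivable f p v by apply/derivable_mxP => i j; rewrite !ord1; have [] := fi j.
apply: DeriveDef => //; rewrite derive_mx//.
by apply/rowP => i; rewrite mxE; have [_ ->] := fi i.
Qed.

Lemma derive_coord n (f : V -> 'rV[R]_n) (p v : V) (i : 'I_n) :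
  derivable f p v -> 'D_v f p 0 i = 'D_v (fun q => f q 0 i) p.
Proof. by move=> fd; rewrite derive_mx// mxE. Qed.

Lemma is_derive_scale n (a : V -> R) (f : V -> 'rV[R]_n) (p v : V)
    (da : R) (df : 'rV[R]_n) :
  is_derive p v a da -> is_derive p v f df ->
  is_derive p v (fun q => a q *: f q) (da *: f p + a p *: df).
Proof.
move=> ha /is_derive_rowP hf; apply/is_derive_rowP => i.
rewrite (_ : (fun _ => _) = a * (fun q => f q 0 i)); last first.
  by apply/funext => q; rewrite !mxE.
by apply: is_derive_eq; rewrite !mxE /= addrC; congr (_ + _); rewrite [LHS]mulrC.
Qed.

End is_derive_row.

Section is_derive3.
Context {R : realType} {V : normedModType R}.
Implicit Types (f g : V -> 'rV[R]_3) (p v : V) (df dg : 'rV[R]_3).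

Lemma is_derive_dotv f g p v df dg :
  is_derive p v f df -> is_derive p v g dg ->
  is_derive p v (fun q => dotv (f q) (g q)) (dotv df (g p) + dotv (f p) dg).
Proof.
move=> /is_derive_rowP hf /is_derive_rowP hg.
rewrite (_ : (fun _ => _) =
  (fun q => f q 0 0) * (fun q => g q 0 0) +
  (fun q => f q 0 1) * (fun q => g q 0 1) +
  (fun q => f q 0 2%:R) * (fun q => g q 0 2%:R)); last first.
  by apply/funext => q; rewrite dotvE.
have d0 := is_deriveM (hf 0) (hg 0); have d1 := is_deriveM (hf 1) (hg 1).
have d := is_deriveD (is_deriveD d0 d1) (is_deriveM (hf 2%:R) (hg 2%:R)).
by apply: (is_derive_eq d); rewrite !dotvE /GRing.scale /=; ring.
Qed.

Lemma is_derive_crossv f g p v df dg :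
  is_derive p v f df -> is_derive p v g dg ->
  is_derive p v (fun q => crossv (f q) (g q))
    (crossv df (g p) + crossv (f p) dg).
Proof.
move=> /is_derive_rowP hf /is_derive_rowP hg; apply/is_derive_rowP => i.
have h j k : is_derive p v (fun q => f q 0 j * g q 0 k - f q 0 k * g q 0 j)
    (df 0 j * g p 0 k + f p 0 j * dg 0 k - (df 0 k * g p 0 j + f p 0 k * dg 0 j)).
  rewrite (_ : (fun _ => _) = (fun q => f q 0 j) * (fun q => g q 0 k) -
     (fun q => f q 0 k) * (fun q => g q 0 j)) //.
  have d := is_deriveB (is_deriveM (hf j) (hg k)) (is_deriveM (hf k) (hg j)).
  by apply: (is_derive_eq d); rewrite /GRing.scale /=; ring.
have := h (i + 1) (i + 2%:R).
rewrite (_ : (fun q => _) = fun q => crossv (f q) (g q) 0 i); last first.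
  by apply/funext => q; rewrite mxE.
by move=> hh; apply: is_derive_eq hh _; rewrite !mxE; ring.
Qed.

End is_derive3.

(** * Calculus of smooth functions *)

Section Ck_theory.
Context {R : realType} {V : normedModType R}.
Implicit Types (k : nat) (U : set V).

Lemma differentiable_rowP n (f : V -> 'rV[R]_n) (p : V) :
  differentiable f p <-> forall i, differentiable (fun q => f q 0 i) p.
Proof.
split=> [fp i|fi].
  apply: (@differentiable_comp _ _ _ _ f (fun N : 'rV[R]_n => N 0 i)) => //.
  exact: differentiable_coord.
rewrite (_ : f = \sum_(i < n) (fun q => f q 0 i *: delta_mx 0 i)).
  by apply: differentiable_sum => i; exact: differentiableZl.
by apply/funext => q; rewrite fct_sumE {1}(row_sum_delta (f q)).
Qed.

Lemma Ck_onW (W : normedModType R) k U (f : V -> W) :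
  Ck_on k.+1 U f -> Ck_on k U f.
Proof.
elim: k f => [|k IHk] f [fd fD].
  by move=> q Uq; apply: differentiable_continuous; exact: fd.
by split=> // v; exact/IHk/fD.
Qed.

Lemma Ck_on_sub (W : normedModType R) k U U' (f : V -> W) :
  U' `<=` U -> Ck_on k U f -> Ck_on k U' f.
Proof.
move=> U'U; elim: k f => [|k IHk] f; first by move=> h q /U'U; exact: h.
by move=> [fd fD]; split=> [q /U'U|v]; [exact: fd|exact/IHk/fD].
Qed.

(** Openness of the domain makes the equality local, so that it passes to
    derivatives of all orders. *)
Lemma eq_Ck_on (W : normedModType R) k U (f g : V -> W) :
  open U -> (forall q, U q -> f q = g q) -> Ck_on k U f -> Ck_on k U g.
Proof.
move=> oU; elim: k f g => [|k IHk] f g fg.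
  move=> fc q Uq; have nfg : \forall x \near q, f x = g x.
    by move: (open_nbhs_nbhs (conj oU Uq)); apply: filterS.
  rewrite /prop_for /continuous_at -(fg q Uq); apply: cvg_trans (fc q Uq).
  by apply: near_eq_cvg; move: nfg; apply: filterS => ? ->.
move=> [fd fD]; have near_fg q : U q -> \forall x \near q, f x = g x.
  by move=> Uq; move: (open_nbhs_nbhs (conj oU Uq)); apply: filterS.
split=> [q Uq|v].
  by apply: differentiable_near (fd q Uq); exact: near_fg.
by apply: IHk (fD v) => q Uq; apply: near_eq_derive; exact: near_fg.
Qed.

Lemma Ck_on_cst (W : normedModType R) k U (a : W) : Ck_on k U (cst a).
Proof.
elim: k a => [|k IHk] a; first by move=> q _; exact: cvg_cst.
split=> [q _|v]; first exact: differentiable_cst.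
rewrite (_ : (fun _ => _) = cst 0) //.
by apply/funext => q; exact: derive_cst.
Qed.

Lemma Ck_onD (W : normedModType R) k U (f g : V -> W) :
  open U -> Ck_on k U f -> Ck_on k U g -> Ck_on k U (fun q => f q + g q).
Proof.
move=> oU; elim: k f g => [|k IHk] f g.
  by move=> fc gc q Uq; apply: (@cvgD); [exact: fc|exact: gc].
move=> [fd fD] [gd gD]; split=> [q Uq|v].
  by apply: differentiableD; [exact: fd|exact: gd].
have := IHk _ _ (fD v) (gD v); apply: (eq_Ck_on oU) => q Uq /=.
by rewrite -deriveD//; exact/diff_derivable/gd || exact/diff_derivable/fd.
Qed.

Lemma Ck_onM k U (f g : V -> R) :
  open U -> Ck_on k U f -> Ck_on k U g -> Ck_on k U (fun q => f q * g q).
Proof.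
move=> oU; elim: k f g => [|k IHk] f g.
  by move=> fc gc q Uq; apply: (@cvgM); [exact: fc|exact: gc].
move=> fk gk; have [fd fD] := fk; have [gd gD] := gk; split=> [q Uq|v].
  by apply: differentiableM; [exact: fd|exact: gd].
have := Ck_onD oU (IHk _ _ (Ck_onW fk) (gD v)) (IHk _ _ (Ck_onW gk) (fD v)).
apply: (eq_Ck_on oU) => q Uq /=.
by rewrite -deriveM//; exact/diff_derivable/gd || exact/diff_derivable/fd.
Qed.

Lemma Ck_onN k U (f : V -> R) :
  open U -> Ck_on k U f -> Ck_on k U (fun q => - f q).
Proof.
move=> oU fk; have := Ck_onM oU (@Ck_on_cst R k U (-1)) fk.
by apply: (eq_Ck_on oU) => q _; rewrite mulN1r.
Qed.

Lemma Ck_onB k U (f g : V -> R) :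
  open U -> Ck_on k U f -> Ck_on k U g -> Ck_on k U (fun q => f q - g q).
Proof. by move=> oU fk gk; exact/Ck_onD/Ck_onN. Qed.

Lemma Ck_on_coord n k U (f : V -> 'rV[R]_n) i :
  open U -> Ck_on k U f -> Ck_on k U (fun q => f q 0 i).
Proof.
move=> oU; elim: k f => [|k IHk] f.
  move=> fc q Uq.
  exact: (@continuous_comp _ _ _ f (fun N : 'rV[R]_n => N 0 i) q (fc q Uq)
     (@coord_continuous _ _ _ _ _ _)).
move=> [fd fD]; split=> [q Uq|v].
  by have /differentiable_rowP := fd q Uq; exact.
have := IHk _ (fD v); apply: (eq_Ck_on oU) => q Uq.
by rewrite derive_mx ?mxE//; exact/diff_derivable/fd.
Qed.

Lemma Ck_on_row n k U (f : V -> 'rV[R]_n) :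
  open U -> (forall i, Ck_on k U (fun q => f q 0 i)) -> Ck_on k U f.
Proof.
move=> oU; elim: k f => [|k IHk] f fk.
  move=> q Uq; apply/cvgrPdist_le => e e0.
  have : \forall x \near q, forall i, `|f q 0 i - f x 0 i| <= e.
    by apply: filter_forall => i; exact: (cvgrPdist_le _ _).1 (fk i q Uq) e e0.
  apply: filterS => x hx.
  rewrite /Num.Def.normr/= mx_normrE (bigmax_le _ (ltW e0))//= => -[i j] _.
  by rewrite !mxE !ord1.
have fd q : U q -> differentiable f q.
  by move=> Uq; apply/differentiable_rowP => i; have [h _] := fk i; exact: h.
split=> // v; apply: IHk => i; have [_ /(_ v)] := fk i.
apply: (eq_Ck_on oU) => q Uq.
by rewrite derive_mx ?mxE//; exact/diff_derivable/fd.
Qed.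

Lemma Ck_on_scale n k U (a : V -> R) (f : V -> 'rV[R]_n) : open U ->
  Ck_on k U a -> Ck_on k U f -> Ck_on k U (fun q => a q *: f q).
Proof.
move=> oU ak fk; apply: Ck_on_row => // i.
have := Ck_onM oU ak (Ck_on_coord i oU fk); apply: (eq_Ck_on oU) => q _.
by rewrite !mxE.
Qed.

Lemma Ck_on_dotv k U (f g : V -> 'rV[R]_3) : open U ->
  Ck_on k U f -> Ck_on k U g -> Ck_on k U (fun q => dotv (f q) (g q)).
Proof.
move=> oU fk gk.
apply: (eq_Ck_on oU (f := fun q => f q 0 0 * g q 0 0 + f q 0 1 * g q 0 1 +
  f q 0 2%:R * g q 0 2%:R)); first by move=> q _; rewrite dotvE.
by do 2?[apply: Ck_onD => //]; apply: Ck_onM => //; exact: Ck_on_coord.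
Qed.

Lemma Ck_on_crossv k U (f g : V -> 'rV[R]_3) : open U ->
  Ck_on k U f -> Ck_on k U g -> Ck_on k U (fun q => crossv (f q) (g q)).
Proof.
move=> oU fk gk; apply: Ck_on_row => // i.
apply: (eq_Ck_on oU (f := fun q => f q 0 (i + 1) * g q 0 (i + 2%:R) -
   f q 0 (i + 2%:R) * g q 0 (i + 1))); first by move=> q _; rewrite mxE.
by apply: Ck_onB => //; apply: Ck_onM => //; exact: Ck_on_coord.
Qed.

End Ck_theory.

Section Ck_comp.
Context {R : realType} {V : normedModType R}.

Lemma derive_real (W : normedModType R) (h : R -> W) (x v : R) :
  differentiable h x -> 'D_v h x = v *: 'D_1 h x.
Proof.
by move=> hd; rewrite !deriveE// -linearZ /= [_ *: _]mulr1.
Qed.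

Lemma is_derive_comp_real (W : normedModType R) (h : R -> W) (phi : V -> R)
    (q v : V) (dphi : R) (dh : W) : differentiable phi q ->
  is_derive q v phi dphi -> is_derive (phi q) 1 h dh ->
  is_derive q v (fun x => h (phi x)) (dphi *: dh).
Proof.
move=> phid [_ <-] [/derivable1_diffP hd <-].
have cd : differentiable (h \o phi) q by exact: differentiable_comp.
apply: DeriveDef; first exact: diff_derivable.
by rewrite deriveE// diff_comp//= -!deriveE// derive_real.
Qed.

(** The induction goes through because the chain rule gives
    ['D_v phi * (h' \o phi)], a product whose second factor has the same shape. *)
Lemma Ck_on_comp k (U : set V) (A : set R) (h : R -> R) (phi : V -> R) :
  open U -> (forall q, U q -> A (phi q)) ->
  Ck_on k A h -> Ck_on k U phi -> Ck_on k U (fun q => h (phi q)).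
Proof.
move=> oU UA; elim: k h => [|k IHk] h.
  move=> hc pc q Uq; apply: (@continuous_comp _ _ _ phi h).
    exact: pc.
  exact/hc/UA.
move=> [hd hD] phik; have [pd pD] := phik; split=> [q Uq|v].
  by apply: (differentiable_comp (pd q Uq)); exact/hd/UA.
have := Ck_onM oU (pD v) (IHk _ (hD 1) (Ck_onW phik)); apply: (eq_Ck_on oU) => q Uq.
have dq := pd q Uq; have dh := hd _ (UA q Uq).
have dq1 : is_derive q v phi ('D_v phi q) by exact/derivableP/diff_derivable.
have dh1 : is_derive (phi q) 1 h ('D_1 h (phi q)).
  exact/derivableP/diff_derivable.
by have [_ ->] := is_derive_comp_real dq dq1 dh1.
Qed.

Lemma Ck_on_comp_row n k (U : set V) (A : set R) (h : R -> 'rV[R]_n)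
    (phi : V -> R) : open U -> open A -> (forall q, U q -> A (phi q)) ->
  Ck_on k A h -> Ck_on k U phi -> Ck_on k U (fun q => h (phi q)).
Proof.
move=> oU oA UA hk phik; apply: Ck_on_row => // i.
exact: (Ck_on_comp oU UA (Ck_on_coord i oA hk) phik).
Qed.

Lemma Ck_on_proj n k (U : set 'rV[R]_n) i : open U ->
  Ck_on k U (fun q : 'rV[R]_n => q 0 i : R).
Proof.
move=> oU; apply: Ck_on_coord => //; elim: k => [|k IHk]; first by move=> q _ ?.
split=> [q _|v]; first exact: ex_diff.
rewrite (_ : (fun _ => _) = cst v); first exact: Ck_on_cst.
by apply/funext => q; exact: derive_id.
Qed.

End Ck_comp.

Section Ck_real.
Context {R : realType}.
Implicit Types (k : nat).

(** On the line every directional derivative is a multiple of the derivative in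
    direction [1]. *)
Lemma Ck_on_realS (W : normedModType R) k (A : set R) (f f' : R -> W) :
  open A -> (forall x, A x -> is_derive x 1 f (f' x)) ->
  (forall v : R, Ck_on k A (fun x => v *: f' x)) ->
  Ck_on k.+1 A f.
Proof.
move=> oA ff' f'k.
have fd x : A x -> differentiable f x.
  by move=> /ff'[fd _]; exact/derivable1_diffP.
split=> // v; have := f'k v; apply: (eq_Ck_on oA) => x Ax.
by rewrite (derive_real _ (fd x Ax)); have [_ ->] := ff' x Ax.
Qed.

Lemma smooth_on_curve n (c : R -> 'rV[R]_n) :
  (forall k u, derivable (c^`(k))%classic u 1) -> smooth_on setT c.
Proof.
move=> cd k; elim: k c cd => [|k IHk] c cd.
  move=> x _; apply: differentiable_continuous.
  exact/derivable1_diffP/(cd 0%N).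
apply: (@Ck_on_realS _ _ _ _ (c^`())%classic) => [|x _|v].
- exact: openT.
- by rewrite derive1E; exact/derivableP/(cd 0%N).
apply: Ck_on_scale; [exact: openT|exact: Ck_on_cst|apply: IHk => j u].
by rewrite -derive1Sn.
Qed.

(** Each function is the derivative of the other up to sign, whence the joint
    induction. *)
Lemma smooth_on_sincos k :
  Ck_on k setT (@sin R) /\ Ck_on k setT (@cos R).
Proof.
elim: k => [|k [IHs IHc]].
  by split=> x _; [exact: continuous_sin|exact: continuous_cos].
split; [apply: (@Ck_on_realS _ _ _ _ cos)|
        apply: (@Ck_on_realS _ _ _ _ (fun x => - sin x))];
  do ?exact: openT; move=> x; do ?by move=> _; exact: is_derive_eq.
- by apply: Ck_onM => //; [exact: openT|exact: Ck_on_cst].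
- apply: Ck_onM => //; [exact: openT|exact: Ck_on_cst|].
  by apply: Ck_onN => //; exact: openT.
Qed.

Definition rsqrt (x : R) := (Num.sqrt x)^-1.

Lemma sqr_rsqrt x : 0 < x -> rsqrt x ^+ 2 * x = 1.
Proof.
by move=> x0; rewrite /rsqrt exprVn sqr_sqrtr ?ltW// mulVf// gt_eqF.
Qed.

(** The derivative is a monomial in [rsqrt] itself, so smoothness follows by
    induction from that of products. *)
Lemma is_derive1_rsqrt (x : R) : 0 < x ->
  is_derive x 1 rsqrt (- 2^-1 * rsqrt x ^+ 3).
Proof.
move=> x0; have sx0 : 0 < Num.sqrt x by rewrite sqrtr_gt0.
have ds := is_derive1_sqrt x0.
apply: is_derive_eq; first by apply: is_deriveV; rewrite gt_eqF.
rewrite /rsqrt /GRing.scale /=; field.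
exact: lt0r_neq0.
Qed.

Lemma smooth_on_rsqrt k : Ck_on k [set x : R | 0 < x] rsqrt.
Proof.
have oA := @open_gt R 0.
elim: k => [|k IHk].
  move=> x /= x0; have [h _] := is_derive1_rsqrt x0.
  by apply: differentiable_continuous; exact/derivable1_diffP.
apply: (Ck_on_realS oA is_derive1_rsqrt) => v.
have := Ck_onM oA (Ck_onM oA (Ck_onM oA IHk IHk) IHk)
  (@Ck_on_cst R R R k _ (v * - 2^-1)).
apply: (eq_Ck_on oA) => x _ /=.
rewrite /GRing.scale /=; ring.
Qed.

End Ck_real.

(** * The Frenet frame of a closed curve *)

Section smooth_curves.
Context {R : realType}.

Lemma smooth_onD1 (W : normedModType R) (U : set R) (f : R -> W) :
  smooth_on U f -> smooth_on U ('D_1 f).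
Proof. by move=> fs k; have [_] := fs k.+1; exact. Qed.

Lemma smooth_derivable (W : normedModType R) (f : R -> W) (u : R) :
  smooth_on setT f -> is_derive u 1 f ('D_1 f u).
Proof.
move=> fs; have [fd _] := fs 1%N.
by apply/derivableP/diff_derivable; exact: fd.
Qed.

Lemma periodic_derive (W : normedModType R) (f : R -> W) (l u : R) :
  (forall u, f (u + l) = f u) -> 'D_1 f (u + l) = 'D_1 f u.
Proof.
move=> fl; rewrite /derive.
rewrite (_ : (fun h => _) = (fun h => h^-1 *: ((f \o shift u) (h *: 1) - f u)))//.
by apply/funext => h /=; rewrite addrA !fl.
Qed.

End smooth_curves.

Section frenet.
Context {R : realType} (l : R) (c : R -> 'rV[R]_3).
Hypothesis c_closed : closed_smooth_curve l c.
Hypothesis c_arc_length : arc_length_parametrized c.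
Hypothesis c_curved : forall u, curvature c u != 0.

Implicit Types u : R.

Local Notation t := (tangent c).
Local Notation n := (principal_normal c).
Local Notation b := (binormal c).
Local Notation kappa := (curvature c).
Local Notation tau := (torsion c).

Lemma smooth_curve : smooth_on setT c.
Proof. by case: c_closed => cd _; exact: smooth_on_curve. Qed.

Lemma tangentE : t = 'D_1 c.
Proof. by apply/funext => u; rewrite /tangent derive1E. Qed.

Lemma is_derive_curve u : is_derive u 1 c (t u).
Proof. by rewrite tangentE; exact/smooth_derivable/smooth_curve. Qed.

Lemma smooth_tangent : smooth_on setT t.
Proof. by rewrite tangentE; exact/smooth_onD1/smooth_curve. Qed.

Lemma tangent_unit u : dotv (t u) (t u) = 1.
Proof. by apply/enorm1; exact: c_arc_length. Qed.

Lemma curvature_gt0 u : 0 < kappa u.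
Proof. by rewrite lt0r c_curved sqrtr_ge0. Qed.

Lemma tangent'E u : 'D_1 t u = kappa u *: n u.
Proof. by rewrite /principal_normal scalerA mulfV// scale1r derive1E. Qed.

Lemma is_derive_tangent u : is_derive u 1 t (kappa u *: n u).
Proof. by rewrite -tangent'E; exact/smooth_derivable/smooth_tangent. Qed.

Lemma curvatureE u : kappa u = Num.sqrt (dotv ('D_1 t u) ('D_1 t u)).
Proof. by rewrite /curvature derive1E. Qed.

Lemma dotv_tangent'_gt0 u : 0 < dotv ('D_1 t u) ('D_1 t u).
Proof. by have := curvature_gt0 u; rewrite curvatureE sqrtr_gt0. Qed.

Lemma smooth_dotv_tangent' :
  smooth_on setT (fun u => dotv ('D_1 t u) ('D_1 t u)).
Proof.
by move=> k; apply: Ck_on_dotv; [exact: openT|..];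
  exact/smooth_onD1/smooth_tangent.
Qed.

Lemma smooth_curvatureV : smooth_on setT (fun u => (kappa u)^-1).
Proof.
move=> k; rewrite (_ : (fun _ => _) =
   (fun u => rsqrt (dotv ('D_1 t u) ('D_1 t u)))); last first.
  by apply/funext => u; rewrite curvatureE.
apply: Ck_on_comp (@smooth_on_rsqrt R k) (smooth_dotv_tangent' k).
- exact: openT.
- by move=> u _; exact: dotv_tangent'_gt0.
Qed.

(** [kappa] is [kappa^-1] times its square, which is a polynomial in [t']. *)
Lemma smooth_curvature : smooth_on setT kappa.
Proof.
move=> k; have := Ck_onM openT (smooth_curvatureV k) (smooth_dotv_tangent' k).
apply: (eq_Ck_on openT) => u _.
rewrite -sqr_enorm /curvature -derive1E expr2 mulrA mulVf ?mul1r//.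
exact: c_curved.
Qed.

Lemma smooth_normal : smooth_on setT n.
Proof.
move=> k; rewrite (_ : n = fun u => (kappa u)^-1 *: 'D_1 t u); last first.
  by apply/funext => u; rewrite /principal_normal derive1E.
apply: Ck_on_scale; [exact: openT|exact: smooth_curvatureV|].
exact/smooth_onD1/smooth_tangent.
Qed.

Lemma smooth_binormal : smooth_on setT b.
Proof.
move=> k; apply: Ck_on_crossv; [exact: openT|exact: smooth_tangent|].
exact: smooth_normal.
Qed.

Lemma smooth_torsion : smooth_on setT tau.
Proof.
move=> k; rewrite (_ : tau = fun u => dotv ('D_1 n u) (b u)); last first.
  by apply/funext => u; rewrite /torsion derive1E.
apply: Ck_on_dotv; [exact: openT|exact/smooth_onD1/smooth_normal|].
exact: smooth_binormal.
Qed.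

Lemma is_derive_cst_unique (f : R -> R) (x a df : R) :
  is_derive x 1 f df -> f = cst a -> df = 0.
Proof. by move=> [_ <-] ->; rewrite derive_cst. Qed.

Lemma dotv_tangent_normal u : dotv (t u) (n u) = 0.
Proof.
have dt := is_derive_tangent u.
have : dotv (kappa u *: n u) (t u) + dotv (t u) (kappa u *: n u) = 0.
  apply: is_derive_cst_unique (is_derive_dotv dt dt) (_ : _ = cst 1).
  by apply/funext => v; exact: tangent_unit.
rewrite (dotvC _ (t u)) dotvZr => h; apply: (mulfI (c_curved u)); lra.
Qed.

Lemma normal_unit u : dotv (n u) (n u) = 1.
Proof.
rewrite /principal_normal !dotv_lin -sqr_enorm -/(curvature c u).
by field; exact: c_curved.
Qed.

Lemma frenet_orthonormal u : orthonormal3 (t u) (n u) (b u).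
Proof.
by apply: orthonormal_cross;
  [exact: tangent_unit|exact: normal_unit|exact: dotv_tangent_normal].
Qed.

(** The components on [n] and [t] come from differentiating [n . n = 1] and
    [n . t = 0]; the component on [b] defines the torsion. *)
Lemma is_derive_normal u :
  is_derive u 1 n (- kappa u *: t u + tau u *: b u).
Proof.
have dn := smooth_derivable u smooth_normal.
apply: (is_derive_eq dn).
rewrite (orthonormal_expand ('D_1 n u) (frenet_orthonormal u)).
have -> : dotv ('D_1 n u) (n u) = 0.
  have : dotv ('D_1 n u) (n u) + dotv (n u) ('D_1 n u) = 0.
    apply: is_derive_cst_unique (is_derive_dotv dn dn) (_ : _ = cst 1).
    by apply/funext => v; exact: normal_unit.
  by rewrite (dotvC (n u)); lra.
have -> : dotv ('D_1 n u) (t u) = - kappa u.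
  have : dotv ('D_1 n u) (t u) + dotv (n u) (kappa u *: n u) = 0.
    apply: is_derive_cst_unique (is_derive_dotv dn (is_derive_tangent u))
      (_ : _ = cst 0).
    by apply/funext => v; rewrite dotvC dotv_tangent_normal.
  by rewrite dotvZr normal_unit; lra.
by rewrite /torsion derive1E scale0r addr0.
Qed.

(** The term [t' x n] vanishes since [t'] is a multiple of [n], and in [t x n']
    only [tau t x b = - tau n] survives. *)
Lemma is_derive_binormal u : is_derive u 1 b (- tau u *: n u).
Proof.
apply: is_derive_eq; first exact: is_derive_crossv (is_derive_tangent u) (is_derive_normal u).
have tt := tangent_unit u; have tn := dotv_tangent_normal u.
have tbE := crossvA (t u) (t u) (n u); rewrite -/(binormal c u) in tbE.
move: tn tbE; move: (t u) (n u) (b u) tt => a0 n0 b0 tt tn tbE.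
rewrite [X in _ + X](_ : _ = tau u *: crossv a0 b0); last first.
  by apply: row3P; rewrite !(crossvE, mxE); ring.
rewrite [X in X + _](_ : _ = 0) ?add0r; last first.
  by apply: row3P; rewrite !(crossvE, mxE); ring.
by rewrite tbE tn tt scale0r sub0r scale1r scalerN scaleNr.
Qed.

Lemma periodic_tangent u : t (u + l) = t u.
Proof. by rewrite tangentE; apply: periodic_derive; case: c_closed. Qed.

Lemma periodic_curvature u : kappa (u + l) = kappa u.
Proof. by rewrite !curvatureE !(periodic_derive _ periodic_tangent). Qed.

Lemma periodic_normal u : n (u + l) = n u.
Proof.
by rewrite /principal_normal periodic_curvature !derive1E
           (periodic_derive _ periodic_tangent).
Qed.

Lemma periodic_binormal u : b (u + l) = b u.
Proof. by rewrite /binormal periodic_tangent periodic_normal. Qed.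

Lemma periodic_torsion u : tau (u + l) = tau u.
Proof.
by rewrite /torsion periodic_binormal !derive1E (periodic_derive _ periodic_normal).
Qed.

End frenet.

(** * Antiderivatives *)

Section antiderivative.
Context {R : realType}.
Local Notation mu := (@lebesgue_measure R).

Lemma continuous_integrable_itv (f : R -> R) (a b : R) : continuous f ->
  mu.-integrable `[a, b] (EFin \o f).
Proof.
move=> fc; apply: continuous_compact_integrable; first exact: segment_compact.
exact: continuous_subspaceT.
Qed.

Lemma Rintegral_chasles (f : R -> R) (a b x : R) : continuous f ->
  a <= b -> b <= x ->
  \int[mu]_(t in `[a, x]) f t =
  \int[mu]_(t in `[a, b]) f t + \int[mu]_(t in `[b, x]) f t.
Proof.
move=> fc ab bx.
have fi := @continuous_integrable_itv f _ _ fc.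
have := @Rintegral_itvB R f (BLeft a) (BRight x) b (fi a x).
rewrite !bnd_simp => /(_ ab bx) /eqP; rewrite subr_eq addrC => /eqP ->.
rewrite Rintegral_itv_obnd_cbnd//; apply: integrableS (fi b x) => //.
exact: subset_itv_oc_cc.
Qed.

(** Integrals from a base point differentiate only to the right of it; moving
    the base point to the left changes the integral by a constant, whence an
    antiderivative on the whole line. *)
Lemma continuous_antiderivative (f : R -> R) : continuous f ->
  exists2 T : R -> R, forall u : R, is_derive u 1 T (f u) &
  forall a b, a < b -> \int[mu]_(u in `[a, b]) f u = T b - T a.
Proof.
move=> fc; pose I a x := \int[mu]_(t in `[a, x]) f t.
pose T u := I (- `|u| - 1) u - I (- `|u| - 1) 0.
have TE a u : a <= u -> a <= 0 -> T u = I a u - I a 0.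
  move=> au a0; rewrite /T; set a' := - `|u| - 1.
  have a'u : a' <= u by rewrite /a'; have := ler_norm (- u); rewrite normrN; lra.
  have a'0 : a' <= 0 by rewrite /a'; have := normr_ge0 u; lra.
  case: (leP a a') => aa'.
    by rewrite /I (Rintegral_chasles fc aa' a'u) (Rintegral_chasles fc aa' a'0); ring.
  move/ltW in aa'.
  by rewrite /I (Rintegral_chasles fc aa' au) (Rintegral_chasles fc aa' a0); ring.
have dT (u : R) : is_derive u 1 T (f u).
  pose a := - `|u| - 1.
  have au : a < u by rewrite /a; have := ler_norm (- u); rewrite normrN; lra.
  have a0 : a <= 0 by rewrite /a; have := normr_ge0 u; lra.
  have uu1 : u < u + 1 by lra.
  have [Id IE] := continuous_FTC1_closed uu1
    (@continuous_integrable_itv _ a (u + 1) fc) au (fc u).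
  apply: (@near_eq_is_derive _ _ _ (fun x => I a x - I a 0)).
    near=> x; rewrite (TE a)//; near: x.
    by apply: filterS (lt_nbhsr au) => x /ltW.
  have -> : f u = f u - 0 by rewrite subr0.
  by apply: is_deriveB; rewrite -IE derive1E; exact/derivableP.
exists T => // a b ab.
pose d := Num.min a 0; have da : d <= a by rewrite ge_min lexx.
have d0 : d <= 0 by rewrite ge_min lexx orbT.
rewrite (TE d b)// ?(TE d a)//; last exact: le_trans (ltW ab).
by rewrite /I (Rintegral_chasles fc da (ltW ab)); ring.
Unshelve. all: by end_near. Qed.

End antiderivative.

(** * Periodic functions *)

Section periodicity.
Context {R : realType}.

Lemma periodic_int (T : Type) (f : R -> T) (l : R) :
  (forall u, f (u + l) = f u) -> forall (m : int) u, f (u + m%:~R * l) = f u.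
Proof.
move=> fl; have fn (k : nat) u : f (u + k%:R * l) = f u.
  elim: k u => [|k IHk] u; first by rewrite mul0r addr0.
  by rewrite -addn1 natrD mulrDl mul1r addrA fl IHk.
case=> k u; first exact: fn.
by rewrite NegzE -(fn k.+1); congr f; rewrite mulrNz; ring.
Qed.

Lemma period_reduction (l : R) : 0 < l ->
  forall u, exists m : int, 0 <= u - m%:~R * l < l.
Proof.
move=> l0 u; exists (Num.floor (u / l)).
have h1 : (Num.floor (u / l))%:~R <= u / l by exact: floor_le_tmp.
have h2 : u / l < (Num.floor (u / l) + 1)%:~R by exact: floorD1_gt.
move: h1 h2; rewrite ler_pdivlMr// ltr_pdivrMr// intrD mulrDl mul1r => h1 h2.
by apply/andP; split; lra.
Qed.

(** After reduction to a period the cosine is injective on the first half of it,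
    and the reflection [y |-> 2 pi - y] brings the second half back to the first. *)
Lemma cos_eq1 (x : R) : cos x = 1 -> exists m : int, x = 2 * pi * m%:~R.
Proof.
have pi0 := pi_gt0 R; have pi20 : 0 < pi *+ 2 :> R by rewrite mulrn_wgt0.
move=> x1; have [m /andP[y0 yl]] := period_reduction pi20 x.
exists m; set y := x - _ in y0 yl.
suff : y = 0 by rewrite /y => /subr0_eq ->; ring.
have cy : cos y = 1.
  rewrite -x1 -(periodic_int (@cosD2pi R) m y); congr cos.
  by rewrite /y; ring.
have cos_1 z : 0 <= z <= pi -> cos z = 1 -> z = 0.
  move=> z0 z1; apply: cos_inj; rewrite ?z1 ?cos0// in_itv//=.
  by rewrite lexx pi_ge0.
have [ypi|ypi] := leP y pi; first by apply: cos_1; rewrite ?y0.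
have : pi *+ 2 - y = 0; last by move/subr0_eq => h; rewrite h ltxx in yl.
apply: cos_1; first by apply/andP; split; rewrite mulr2n; lra.
by rewrite addrC cosD2pi cosN.
Qed.

End periodicity.

(** * Total torsion and parallel frames *)

(** The normal fields [w] and [nu] do not rotate about the curve [c]: their
    derivatives are tangent to it. This is a rotation-minimizing (Bishop) frame. *)
Record parallel_framing (R : realType) (l : R) (c t w nu : R -> 'rV[R]_3)
    (lam mu : R -> R) : Prop := ParallelFraming {
  framing_curve : forall u : R, is_derive u 1 c (t u);
  framing_orthonormal : forall u : R, orthonormal3 (t u) (w u) (nu u);
  framing_tangent : forall u : R, is_derive u 1 t (lam u *: nu u + mu u *: w u);
  framing_conormal : forall u : R, is_derive u 1 w (- mu u *: t u);
  framing_normal : forall u : R, is_derive u 1 nu (- lam u *: t u);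
  smooth_framing_curve : smooth_on setT c;
  smooth_framing_tangent : smooth_on setT t;
  smooth_framing_conormal : smooth_on setT w;
  smooth_framing_normal : smooth_on setT nu;
  smooth_framing_lam : smooth_on setT lam;
  smooth_framing_mu : smooth_on setT mu;
  framing_periodic : [/\ forall u : R, c (u + l) = c u,
    forall u : R, t (u + l) = t u, forall u : R, w (u + l) = w u,
    forall u : R, nu (u + l) = nu u &
    (forall u : R, lam (u + l) = lam u) /\ (forall u : R, mu (u + l) = mu u)] }.

Section total_torsion.
Context {R : realType} (l : R) (c : R -> 'rV[R]_3).
Hypothesis l_gt0 : 0 < l.
Hypothesis c_closed : closed_smooth_curve l c.
Hypothesis c_arc_length : arc_length_parametrized c.
Hypothesis c_curved : forall u, curvature c u != 0.
Implicit Types u : R.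

Local Notation t := (tangent c).
Local Notation n := (principal_normal c).
Local Notation b := (binormal c).
Local Notation kappa := (curvature c).
Local Notation tau := (torsion c).

Lemma torsion_antiderivative :
  exists2 T : R -> R, forall u, is_derive u 1 T (tau u) &
  \int[lebesgue_measure]_(u in `[0, l]) tau u = T l - T 0.
Proof.
have tau_c : continuous tau by move=> u; exact: (smooth_torsion c_closed c_curved 0).
by have [T dT TE] := continuous_antiderivative tau_c; exists T => //; exact: TE.
Qed.

(** With [x = nu . n] and [y = nu . b] the vector [(x, y)] turned by the angle [T]
    is constant. As [(x, y)] takes the same value, of length one, at [0] and [l],
    the rotations of angles [T 0] and [T l] agree. *)
Lemma parallel_normal_total_torsion (nu : R -> 'rV[R]_3) (lam : R -> R) :
  nu l = nu 0 -> (forall u, dotv (nu u) (nu u) = 1) ->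
  (forall u, dotv (nu u) (t u) = 0) ->
  (forall u, is_derive u 1 nu (- lam u *: t u)) ->
  exists m : int,
    \int[lebesgue_measure]_(u in `[0, l]) tau u = 2 * pi * m%:~R.
Proof.
move=> nul nu1 nut dnu; have [T dT ->] := torsion_antiderivative.
apply: cos_eq1.
have on u := frenet_orthonormal c_closed c_arc_length c_curved u.
have dn u := is_derive_normal c_closed c_arc_length c_curved u.
have db u := is_derive_binormal c_closed c_arc_length c_curved u.
pose x u := dotv (nu u) (n u); pose y u := dotv (nu u) (b u).
have dx u : is_derive u 1 x (tau u * y u).
  apply: is_derive_eq; first exact: is_derive_dotv (dnu u) (dn u).
  have [_ _ _ tn _] := on u.
  rewrite /y; move: (t u) (n u) (b u) (nu u) (nut u) tn => ? ? ? ? nt tn.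
  by rewrite !dotv_lin nt tn; ring.
have dy u : is_derive u 1 y (- tau u * x u).
  apply: is_derive_eq; first exact: is_derive_dotv (dnu u) (db u).
  have [_ _ _ _ [tb _]] := on u.
  rewrite /x; move: (t u) (n u) (b u) (nu u) tb => ? ? ? ? tb.
  by rewrite !dotv_lin tb; ring.
have dcos u : is_derive u 1 (fun v => cos (T v)) (- (tau u * sin (T u))).
  by apply: is_derive_eq; rewrite /GRing.scale /=; ring.
have dsin u : is_derive u 1 (fun v => sin (T v)) (tau u * cos (T u)).
  by apply: is_derive_eq; rewrite /GRing.scale /=; ring.
(* [A] and [B]: the coordinates of [(x, y)] turned by the angle [T] *)
have A : x l * cos (T l) - y l * sin (T l) = x 0 * cos (T 0) - y 0 * sin (T 0).
  apply: (is_derive_0_is_cst (f := fun u => x u * cos (T u) - y u * sin (T u))) => u.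
  have h := is_deriveB (is_deriveM (dx u) (dcos u)) (is_deriveM (dy u) (dsin u)).
  apply: (is_derive_eq h).
  by rewrite /GRing.scale /=; ring.
have B : x l * sin (T l) + y l * cos (T l) = x 0 * sin (T 0) + y 0 * cos (T 0).
  apply: (is_derive_0_is_cst (f := fun u => x u * sin (T u) + y u * cos (T u))) => u.
  have h := is_deriveD (is_deriveM (dx u) (dsin u)) (is_deriveM (dy u) (dcos u)).
  apply: (is_derive_eq h).
  by rewrite /GRing.scale /=; ring.
have xl : x l = x 0.
  by rewrite /x nul -[l]add0r (periodic_normal c_closed).
have yl : y l = y 0.
  by rewrite /y nul -[l]add0r (periodic_binormal c_closed).
have xy : x 0 ^+ 2 + y 0 ^+ 2 = 1.
  rewrite -(nu1 0) (orthonormal_sqr (nu 0) (on 0)) nut /x /y.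
  by ring.
rewrite xl yl in A B; set X := cos (T l) in A B *; set Y := sin (T l) in A B *.
have CS := cos2Dsin2 (T 0); rewrite cosB -/X -/Y -[LHS]mul1r -xy.
transitivity ((x 0 * X - y 0 * Y) * (x 0 * cos (T 0) - y 0 * sin (T 0)) +
  (x 0 * Y + y 0 * X) * (x 0 * sin (T 0) + y 0 * cos (T 0))); first by ring.
rewrite A B; transitivity ((x 0 ^+ 2 + y 0 ^+ 2) *
  (cos (T 0) ^+ 2 + sin (T 0) ^+ 2)); first by ring.
by rewrite xy CS mulr1.
Qed.

(** Turning the Frenet normals back by the accumulated torsion [T] kills their
    rotation; the turned frame has period [l] because [T] increases by a multiple
    of [2 pi] over a period. *)
Lemma exists_parallel_framing (m : int) :
  \int[lebesgue_measure]_(u in `[0, l]) tau u = 2 * pi * m%:~R ->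
  exists w nu lam mu, parallel_framing l c t w nu lam mu.
Proof.
have [T dT ->] := torsion_antiderivative => Tm.
have on u := frenet_orthonormal c_closed c_arc_length c_curved u.
have dt u := is_derive_tangent c_closed c_curved u.
have dn u := is_derive_normal c_closed c_arc_length c_curved u.
have db u := is_derive_binormal c_closed c_arc_length c_curved u.
pose C u := cos (T u); pose S u := sin (T u).
have CS u : C u ^+ 2 + S u ^+ 2 = 1 by exact: cos2Dsin2.
have dC u : is_derive u 1 C (- tau u * S u).
  by apply: is_derive_eq; rewrite /S /GRing.scale /=; ring.
have dS u : is_derive u 1 S (tau u * C u).
  by apply: is_derive_eq; rewrite /C /GRing.scale /=; ring.
have Tk k : Ck_on k setT T.
  case: k => [u _|k].
    by apply: differentiable_continuous; have [h _] := dT u;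
      exact/derivable1_diffP.
  apply: (@Ck_on_realS R R k setT T tau openT (fun u _ => dT u)) => v.
  have tauk := smooth_torsion c_closed c_curved k.
  have vk : Ck_on k setT (cst v : R -> R) by exact: Ck_on_cst.
  exact: (Ck_onM openT vk tauk).
have Ck k : Ck_on k setT C.
  exact: Ck_on_comp openT _ (smooth_on_sincos k).2 (Tk k).
have Sk k : Ck_on k setT S.
  exact: Ck_on_comp openT _ (smooth_on_sincos k).1 (Tk k).
have oT := @openT R.
have nk := smooth_normal c_closed c_curved.
have bk := smooth_binormal c_closed c_curved.
have kk := smooth_curvature c_closed c_curved.
have Tl u : T (u + l) = T u + 2 * pi * m%:~R.
  apply/eqP; rewrite -subr_eq; apply/eqP; rewrite -Tm.
  have : T (u + l) - T u = T (0 + l) - T 0; last by rewrite add0r; lra.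
  apply: (is_derive_0_is_cst (f := fun v => T (v + l) - T v)) => v.
  have ds : is_derive v 1 (fun v => v + l) (1 : R) by exact: is_derive_shift.
  have h := @is_derive1_comp R T (fun v => v + l) v _ _ (dT (v + l)) ds.
  have h' := is_deriveB h (dT v); apply: (is_derive_eq h').
  by rewrite (periodic_torsion c_closed) mulr1 subrr.
have Cl u : C (u + l) = C u.
  by rewrite /C Tl -(periodic_int (@cosD2pi R) m (T u)); congr cos; ring.
have Sl u : S (u + l) = S u.
  by rewrite /S Tl -(periodic_int (@sinD2pi R) m (T u)); congr sin; ring.
pose nu u := C u *: n u + (- S u) *: b u.
pose w u := S u *: n u + C u *: b u.
exists w, nu, (fun u => kappa u * C u), (fun u => kappa u * S u).
split.
- exact: is_derive_curve c_closed.
- move=> u; have [tt nn bb tn [tb nb]] := on u.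
  rewrite /orthonormal3 /w /nu.
  move: (t u) (n u) (b u) tt nn bb tn tb nb => ? ? b0 tt nn bb tn tb nb.
  rewrite !dotv_lin (dotvC b0) tt tn tb nn nb bb.
  split; [by []|rewrite -[RHS](CS u); ring|rewrite -[RHS](CS u); ring|ring|].
  by split; ring.
- move=> u; apply: is_derive_eq (dt u) _; rewrite /nu /w.
  move: (n u) (b u) => n0 b0; apply/rowP => i; rewrite !mxE.
  by transitivity (kappa u * (C u ^+ 2 + S u ^+ 2) * n0 0 i);
    [rewrite CS|]; ring.
- move=> u; apply: is_derive_eq.
    by apply: is_deriveD; [exact: is_derive_scale (dS u) (dn u)|
                           exact: is_derive_scale (dC u) (db u)].
  move: (t u) (n u) (b u) => ? ? ?.
  by apply/rowP => i; rewrite !mxE; ring.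
- move=> u; apply: is_derive_eq.
    by apply: is_deriveD; [exact: is_derive_scale (dC u) (dn u)|
      apply: is_derive_scale (db u); exact: is_deriveN].
  move: (t u) (n u) (b u) => ? ? ?.
  by apply/rowP => i; rewrite !mxE; ring.
- exact: smooth_curve c_closed.
- exact: smooth_tangent c_closed.
- by move=> k; apply: Ck_onD => //; apply: Ck_on_scale.
- by move=> k; apply: Ck_onD => //; apply: Ck_on_scale => //; exact: Ck_onN.
- by move=> k; exact: Ck_onM.
- by move=> k; exact: Ck_onM.
- have nl := periodic_normal c_closed; have bl := periodic_binormal c_closed.
  have kl := periodic_curvature c_closed; split.
  + by case: c_closed.
  + exact: periodic_tangent c_closed.
  + by move=> u; rewrite /w Cl Sl nl bl.
  + by move=> u; rewrite /nu Cl Sl nl bl.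
  + by split=> u; rewrite ?Cl ?Sl kl.
Qed.

End total_torsion.

(** * Symmetry of second derivatives *)

Section schwarz.
Context {R : realType} {V : normedModType R}.

Lemma is_derive_line (f : V -> R) (a q : V) (s : R) :
  differentiable f (s *: a + q) ->
  is_derive s 1 (fun s : R => f (s *: a + q)) ('D_a f (s *: a + q)).
Proof.
move=> fd.
have lined : is_diff s (fun s : R => s *: a + q) (fun s : R => s *: a + 0).
  exact: is_diffD.
have ld : differentiable (fun s : R => s *: a + q) s by [].
have cd : differentiable (f \o (fun s : R => s *: a + q)) s.
  exact: differentiable_comp.
apply: DeriveDef; first exact: diff_derivable.
rewrite deriveE// diff_comp//= deriveE//.
by have -> := @diff_val _ _ _ _ _ _ _ lined; rewrite /= scale1r addr0.
Qed.

(** The mean value theorem in direction [a] turns the second difference into [h]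
    times an increment of ['D_a f] along [h *: b], which the differentiability of
    ['D_a f] at [p] estimates up to [o(h)]. *)
Lemma second_difference (f : V -> R) (p a b : V) (U : set V) : open U -> U p ->
  (forall q, U q -> differentiable f q) -> differentiable ('D_a f) p ->
  forall e, 0 < e -> \forall h \near 0^'+,
    `|f (h *: a + (h *: b + p)) - f (h *: a + p) - (f (h *: b + p) - f p)
      - h ^+ 2 * 'D_b ('D_a f) p| <= e * h ^+ 2.
Proof.
move=> oU Up fd gd e e0.
(* [K * h] bounds the sum of the distances to [p] of the two points at which
   ['D_a f] is expanded. *)
pose K := 2 * `|a| + `|b| + 1.
have K0 : 0 < K by rewrite /K; have := normr_ge0 a; have := normr_ge0 b; lra.
have e'0 : 0 < e / K by rewrite divr_gt0.
have /nbhs_ballP[r /= r0 hr] : nbhs p (fun y => U y /\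
    `|'D_a f y - 'D_a f p - 'd ('D_a f) p (y - p)| <= e / K * `|y - p|).
  apply: filterI; first exact: open_nbhs_nbhs.
  exact: differentiable_approx.
have rK0 : 0 < r / K by rewrite divr_gt0.
near=> h.
have h0 : 0 < h by [].
have hrK : h < r / K.
  by near: h; exact: nbhs_right_lt.
have near_p s t : 0 <= s <= h -> 0 <= t <= h -> 
    ball p r (s *: a + (t *: b + p)).
  move=> /andP[s0 sh] /andP[t0 th]; rewrite -ball_normE /=.
  rewrite addrA opprD addrCA subrr addr0 normrN.
  apply: le_lt_trans (ler_normD _ _) _.
  rewrite !normrZ !ger0_norm//.
  move: hrK; rewrite ltr_pdivlMr//; apply: le_lt_trans.
  have := ler_wpM2r (normr_ge0 a) sh; have := ler_wpM2r (normr_ge0 b) th.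
  have := mulr_ge0 (ltW h0) (normr_ge0 a); rewrite /K; lra.
pose psi s := f (s *: a + (h *: b + p)) - f (s *: a + p).
have near_p0 s : 0 <= s <= h -> ball p r (s *: a + p).
  by move=> sh; have := near_p s 0 sh; rewrite scale0r add0r lexx ltW//; exact.
have near_ph s : 0 <= s <= h -> ball p r (s *: a + (h *: b + p)).
  by move=> sh; apply: near_p => //; rewrite lexx ltW.
have dpsi s : 0 <= s <= h -> is_derive s 1 psi
    ('D_a f (s *: a + (h *: b + p)) - 'D_a f (s *: a + p)).
  move=> sh; apply: is_deriveB; apply: is_derive_line; apply: fd.
    exact: (hr _ (near_ph _ sh)).1.
  exact: (hr _ (near_p0 _ sh)).1.
have [xi xih psiE] : exists2 xi, xi \in `]0, h[ & psi h - psi 0 =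
    ('D_a f (xi *: a + (h *: b + p)) - 'D_a f (xi *: a + p)) * (h - 0).
  apply: (MVT h0) => [x|].
    by rewrite in_itv/= => /andP[x0 xh]; apply: dpsi; rewrite !ltW.
  apply: continuous_in_subspaceT => x; rewrite inE/= in_itv/= => xh.
  by apply: differentiable_continuous; have [h1 _] := dpsi x xh;
     exact/derivable1_diffP.
have xih' : 0 <= xi <= h by move: xih; rewrite in_itv/= => /andP[? ?]; rewrite !ltW.
have -> : f (h *: a + (h *: b + p)) - f (h *: a + p) - (f (h *: b + p) - f p) =
    psi h - psi 0 by rewrite /psi !scale0r !add0r.
rewrite psiE subr0 expr2 -[h * h * _]mulrA mulrC -mulrBr normrM (gtr0_norm h0).
rewrite (mulrC h h) mulrA [leRHS]mulrC ler_pM2l//.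
have [_ h1] := hr _ (near_ph _ xih'); have [_ h2] := hr _ (near_p0 _ xih').
rewrite addrA addrK in h1; rewrite addrK in h2; rewrite addrA.
have dE : 'd ('D_a f) p (xi *: a + h *: b) - 'd ('D_a f) p (xi *: a) =
    h * 'D_b ('D_a f) p.
  by rewrite -linearB addrAC subrr add0r linearZ deriveE.
rewrite -dE.
set y1 := 'D_a f _ in h1 *; set y2 := 'D_a f _ in h2 *.
have -> : y1 - y2 - ('d ('D_a f) p (xi *: a + h *: b) - 'd ('D_a f) p (xi *: a)) =
   (y1 - 'D_a f p - 'd ('D_a f) p (xi *: a + h *: b)) -
   (y2 - 'D_a f p - 'd ('D_a f) p (xi *: a)) by ring.
apply: le_trans (ler_normB _ _) _; apply: le_trans (lerD h1 h2) _.
rewrite -mulrDr -mulrA; apply: (ler_wpM2l (ltW e0)).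
rewrite ler_pdivrMl//.
case/andP: xih' => x0 xh; have := ler_normD (xi *: a) (h *: b).
rewrite !normrZ (ger0_norm x0) (gtr0_norm h0).
have := ler_wpM2r (normr_ge0 a) xh; have := mulr_ge0 (ltW h0) (normr_ge0 b).
rewrite /K => ? ? ?; nra.
Unshelve. all: by end_near. Qed.

(** The second difference is symmetric in the two directions, and both mixed
    derivatives are its limit after division by [h ^+ 2]. *)
Lemma derive_sym (f : V -> R) (p a b : V) (U : set V) : open U -> U p ->
  (forall q, U q -> differentiable f q) ->
  differentiable ('D_a f) p -> differentiable ('D_b f) p ->
  'D_b ('D_a f) p = 'D_a ('D_b f) p.
Proof.
move=> oU Up fd ga gb; apply/eqP; rewrite -subr_eq0 -normr_le0.
apply/ler_addgt0Pl => e e0; rewrite addr0.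
have e20 : 0 < e / 2 by rewrite divr_gt0.
pose sd x y (h : R) := `|f (h *: x + (h *: y + p)) - f (h *: x + p) -
  (f (h *: y + p) - f p) - h ^+ 2 * 'D_y ('D_x f) p| <= e / 2 * h ^+ 2.
have sd_ab : \forall h \near 0^'+, sd a b h := second_difference b oU Up fd ga e20.
have sd_ba : \forall h \near 0^'+, sd b a h := second_difference a oU Up fd gb e20.
have [h [[h0 hX] hY]] := filter_ex
  (filterI (filterI (nbhs_right_gt (0 : R)) sd_ab) sd_ba).
rewrite /sd in hX hY; rewrite (addrCA (h *: b)) in hY.
have h20 : 0 < h ^+ 2 by rewrite exprn_gt0.
set X := 'D_b _ _ in hX *; set Y := 'D_a _ _ in hY *.
rewrite -(ler_pM2l h20) -[X in X * `|_|]gtr0_norm// -normrM.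
set fa := f (h *: a + p) in hX hY; set fb := f (h *: b + p) in hX hY.
set fab := f _ in hX hY.
rewrite (_ : h ^+ 2 * (X - Y) =
  (fab - fb - (fa - f p) - h ^+ 2 * Y) - (fab - fa - (fb - f p) - h ^+ 2 * X));
  last by ring.
apply: le_trans (ler_normB _ _) _; apply: le_trans (lerD hY hX) _.
by rewrite -mulrDl -splitr mulrC.
Qed.

Lemma derive_sym_row n (f : V -> 'rV[R]_n) (p a b : V) (U : set V) :
  open U -> U p -> (forall q, U q -> differentiable f q) ->
  differentiable ('D_a f) p -> differentiable ('D_b f) p ->
  'D_b ('D_a f) p = 'D_a ('D_b f) p.
Proof.
move=> oU Up fd fa fb; apply/rowP => i.
have nearU v : \forall y \near p, 'D_v f y 0 i = 'D_v (fun z => f z 0 i) y.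
  apply: filterS (open_nbhs_nbhs (conj oU Up)) => y Uy.
  by apply: derive_coord; exact/diff_derivable/fd.
have coordE v w : differentiable ('D_v f) p ->
    'D_w ('D_v f) p 0 i = 'D_w ('D_v (fun y => f y 0 i)) p.
  move=> fv; apply: etrans (derive_coord i _) _; first exact: diff_derivable.
  by apply: near_eq_derive; exact: nearU.
have diffE v : differentiable ('D_v f) p ->
    differentiable ('D_v (fun y => f y 0 i)) p.
  move=> /differentiable_rowP/(_ i); apply: differentiable_near; exact: nearU.
apply: etrans (coordE a b fa) (etrans _ (esym (coordE b a fb))).
apply: (derive_sym oU Up) => [q Uq| |]; [|exact: diffE|exact: diffE].
by have /differentiable_rowP := fd q Uq; exact.
Qed.

End schwarz.

(** * Umbilic points along a curve *)

Section umbilic_along.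
Context {R : realType}.

Lemma mulmx_lipschitz n m (P : 'M[R]_(n, m)) :
  exists2 C, 0 < C & forall v : 'rV[R]_n, `|v *m P| <= C * `|v|.
Proof.
have entry k j (M : 'M[R]_(k, j)) i i' : `|M i i'| <= `|M|.
  by rewrite [leRHS]/Num.Def.normr/= mx_normrE (le_bigmax _ _ (i, i')).
exists (n%:R * `|P| + 1) => [|v]; first by apply: ltr_wpDl => //; exact: mulr_ge0.
rewrite [leLHS]/Num.Def.normr/= mx_normrE; apply: bigmax_le => /=.
  by apply: mulr_ge0 => //; apply: addr_ge0 => //; exact: mulr_ge0.
move=> [i j] _ /=; rewrite mxE; apply: le_trans (ler_norm_sum _ _ _) _.
apply: (@le_trans _ _ (\sum_(k < n) (`|v| * `|P|))).
  by apply: ler_sum => k _; rewrite normrM ler_pM//; exact: entry.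
rewrite sumr_const card_ord -[leLHS]mulr_natl mulrA mulrDl mul1r.
by rewrite (mulrAC n%:R) lerDl.
Qed.

(** A right inverse of [J] is Lipschitz. *)
Lemma row_free_expanding n m (J : 'M[R]_(n, m)) : row_free J ->
  exists2 C, 0 < C & forall v : 'rV[R]_n, `|v| <= C * `|v *m J|.
Proof.
move=> /row_freeP[P JP]; have [C C0 hC] := mulmx_lipschitz P; exists C => // v.
by rewrite -[in leLHS](mulmx1 v) -JP mulmxA.
Qed.

Lemma is_derive_littleo (W : normedModType R) (f : R -> W) (u : R) :
  (forall e, 0 < e -> \forall v \near u, `|f v - f u| <= e * `|v - u|) ->
  is_derive u 1 f 0.
Proof.
move=> fo; suff cf : h^-1 *: ((f \o shift u) (h *: 1) - f u) @[h --> 0^'] --> (0 : W).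
  by apply: DeriveDef; [apply/cvg_ex; exists 0|exact: cvg_lim cf].
apply/cvgrPdist_le => e e0; have := fo _ e0.
rewrite [X in X -> _](near_shift 0 u) /= subr0 => fe.
near=> h.
have h0 : h != 0 by near: h; exact: nbhs_dnbhs_neq.
have fh : `|f (h + u) - f u| <= e * `|h + u - u|.
  by near: h; exact: cvg_within fe.
rewrite sub0r normrN normrZ normfV /= [h *: 1]mulr1.
by rewrite ler_pdivrMl ?normr_gt0// mulrC; rewrite addrK in fh.
Unshelve. all: by end_near. Qed.

(** A self-adjoint nilpotent endomorphism vanishes: with [M = A - k], the
    square norm of [w M] is the pairing of [w M M = 0] with [w]. *)
Lemma selfadjoint_scalar (A : 'M[R]_2) (J : 'M[R]_(2, 3)) (k : R) :
  row_free J ->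
  (forall v w : 'rV[R]_2, dotv (v *m A *m J) (w *m J) = dotv (w *m A *m J) (v *m J)) ->
  char_poly A = ('X - k%:P) * ('X - k%:P) -> A = k%:M.
Proof.
move=> Jfree Asym Apoly; pose M := A - k%:M.
have MM : M *m M = 0.
  have := Cayley_Hamilton A; rewrite Apoly rmorphM rmorphB /=.
  by rewrite horner_mx_X horner_mx_C.
have Msym v w : dotv (v *m M *m J) (w *m J) = dotv (w *m M *m J) (v *m J).
  rewrite /M !mulmxBr !mul_mx_scalar !mulmxBl -!scalemxAl.
  rewrite 2!dotvDl 2!dotvNl 2!dotvZl Asym; congr (_ - _ * _); exact: dotvC.
apply/eqP; rewrite -subr_eq0 -/M; apply/eqP/row_matrixP => i.
rewrite row0 rowE; apply/eqP; rewrite -(mulmx_free_eq0 _ Jfree) -dotv_eq0.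
by rewrite Msym -(mulmxA _ M M) MM mulmx0 mul0mx dot0v.
Qed.


Section local_parametrization_facts.
Context {M : topologicalType} {f N : M -> 'rV[R]_3}.
Context {U : set 'rV[R]_2} {x : 'rV[R]_2 -> M}.
Hypothesis Ux : local_parametrization f N U x.
Local Notation F := (f \o x).
Local Notation nu := (N \o x).

Lemma param_open : open U. Proof. by case: Ux => -[]. Qed.

Lemma param_differentiable q : U q -> differentiable F q.
Proof. by case: Ux => _ Fs _ _ _ Uq; have [h _] := Fs 1%N; exact: h. Qed.

Lemma param_normal_differentiable q : U q -> differentiable nu q.
Proof. by case: Ux => _ _ _ Ns _ Uq; have [h _] := Ns 1%N; exact: h. Qed.

Lemma dotv_normal_derive q v : U q -> dotv (nu q) ('D_v F q) = 0.
Proof.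
move=> Uq; have [_ _ _ _ /(_ q Uq)[_ JN]] := Ux.
rewrite deriveEjacobian; last exact: param_differentiable.
have : v *m 'J F q *m (nu q)^T = 0 by rewrite -mulmxA JN mulmx0.
rewrite mulmx_trE dotvC => /matrixP/(_ 0 0).
by rewrite !mxE eqxx mulr1n.
Qed.

(** The second fundamental form is symmetric: both sides are the opposite of
    the normal component of a mixed second derivative. *)
Lemma dotv_derive_normal_sym q v w : U q ->
  dotv ('D_w nu q) ('D_v F q) = dotv ('D_v nu q) ('D_w F q).
Proof.
move=> Uq; have [_ Fs _ _ _] := Ux.
have dF a : differentiable ('D_a F) q.
  by have [_ /(_ a)[h _]] := Fs 2%N; exact: h.
have second a b :
    dotv ('D_a nu q) ('D_b F q) = - dotv (nu q) ('D_a ('D_b F) q).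
  have da : is_derive q a nu ('D_a nu q).
    exact/derivableP/diff_derivable/param_normal_differentiable.
  have db : is_derive q a ('D_b F) ('D_a ('D_b F) q).
    exact/derivableP/diff_derivable.
  have [_ d0] := is_derive_dotv da db.
  apply/eqP; rewrite -addr_eq0 -d0; apply/eqP.
  rewrite -[RHS](derive_cst (0 : R) q a); apply: near_eq_derive.
  apply: filterS (open_nbhs_nbhs (conj param_open Uq)) => y.
  exact: dotv_normal_derive.
apply: etrans (second w v) (etrans _ (esym (second v w))).
have mixed : 'D_w ('D_v F) q = 'D_v ('D_w F) q.
  by apply: (derive_sym_row param_open Uq) => //; exact: param_differentiable.
exact: (congr1 (fun y => - dotv (nu q) y) mixed).
Qed.

(** Self-adjointness of the shape operator turns its double eigenvalue into a
    scalar operator. *)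
Lemma umbilic_jacobian q (A : 'M[R]_2) (k : R) : U q ->
  - 'J nu q = A *m 'J F q -> char_poly A = ('X - k%:P) * ('X - k%:P) ->
  'J nu q = - k *: 'J F q.
Proof.
move=> Uq AE Apoly; have [_ _ /(_ q Uq) Jfree _ _] := Ux.
have Ak : A = k%:M.
  apply: (selfadjoint_scalar Jfree _ Apoly) => v w.
  rewrite -!mulmxA -AE !mulmxN !dotvNl; congr (- _).
  have dFE a : 'D_a F q = a *m 'J F q.
    exact: deriveEjacobian (param_differentiable Uq).
  have dNE a : 'D_a nu q = a *m 'J nu q.
    exact: deriveEjacobian (param_normal_differentiable Uq).
  apply: etrans (esym (congr2 (@dotv R) (dNE v) (dFE w))) _.
  apply: etrans (congr2 (@dotv R) (dNE w) (dFE v)).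
  exact: dotv_derive_normal_sym.
by rewrite -['J nu q]opprK AE Ak mul_scalar_mx scaleNr.
Qed.

(** Read in the parametrization, the curve stays within [O(v - u)] of [q0],
    because the immersion expands lengths up to a constant; so a function of
    the parameters whose differential at [q0] vanishes is [o(v - u)] along the
    curve. *)
Lemma param_curve_derive0 (W : normedModType R) (G : 'rV[R]_2 -> W) (D : R -> W)
    (g : R -> M) (u : R) (q0 : 'rV[R]_2) (dc : 'rV[R]_3) :
  U q0 -> x q0 = g u -> {for u, continuous g} ->
  is_derive u 1 (f \o g) dc ->
  differentiable G q0 -> (forall h, 'D_h G q0 = 0) ->
  (forall v q, x q = g v -> D v = G q) -> is_derive u 1 D 0.
Proof.
have half_absorb (a b d : R) : a <= b + 2^-1 * a -> b <= d -> a <= 2 * d.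
  by lra.
move=> Uq0 xq0 gc [c_der dcE] Gd dG DG.
have [C C0 hC] : exists2 C, 0 < C & forall v : 'rV[R]_2,
    `|v| <= C * `|v *m 'J F q0|.
  by apply: row_free_expanding; case: Ux => _ _ h _ _; exact: h.
apply: is_derive_littleo => e e0.
have c_diff : differentiable (f \o g) u by exact/derivable1_diffP.
pose L := `|dc| + 1; have L0 : 0 < L by rewrite ltr_wpDl.
have cL : \forall v \near u, `|f (g v) - f (g u)| <= L * `|v - u|.
  have := differentiable_approx c_diff ltr01; apply: filterS => v.
  rewrite mul1r => cv.
  rewrite -[f (g v) - f (g u)](subrK ('d (f \o g) u (v - u))).
  apply: le_trans (ler_normD _ _) _.
  rewrite addrC /L mulrDl mul1r; apply: lerD => //.
  by rewrite -deriveE// derive_real// dcE normrZ mulrC.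
have Fd := param_differentiable Uq0.
have e'0 : 0 < e / (2 * C * L) by rewrite divr_gt0// !mulr_gt0.
have C20 : 0 < (2 * C)^-1 by rewrite invr_gt0 mulr_gt0.
have appF := differentiable_approx Fd C20.
have appG := differentiable_approx Gd e'0.
have /nbhs_ballP[r /= r0 hr] : nbhs q0 (fun q =>
    `|F q - F q0 - 'd F q0 (q - q0)| <= (2 * C)^-1 * `|q - q0| /\
    `|G q - G q0 - 'd G q0 (q - q0)| <= e / (2 * C * L) * `|q - q0|).
  by apply: filterI; [exact: appF|exact: appG].
have oV : open (x @` (ball q0 r `&` U)).
  have [[_ _ _ ho] _ _ _ _] := Ux; apply: ho; last by move=> y [].
  by apply: openI; [exact: ball_open|exact: param_open].
have : nbhs (g u) (x @` (ball q0 r `&` U)).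
  apply: open_nbhs_nbhs; split => //; exists q0 => //; split=> //.
  exact: ballxx.
move=> /gc; rewrite /nbhs /=.
apply: filterS2 cL => v cL [q [/hr[hF hG] Uq] xq].
rewrite (DG v q xq) (DG u q0 xq0); rewrite -xq -xq0 in cL.
set h := q - q0 in hF hG.
have hle : `|h| <= 2 * C * L * `|v - u|.
  have hJ : `|h *m 'J F q0| <= `|f (x q) - f (x q0)| + (2 * C)^-1 * `|h|.
    rewrite -(etrans (esym (deriveE h Fd)) (deriveEjacobian h Fd)).
    set d := f _ - _; rewrite -[X in `|X|](subKr d).
    exact: le_trans (ler_normB _ _) (lerD (lexx _) hF).
  have := le_trans (hC h) (ler_wpM2l (ltW C0) hJ).
  rewrite mulrDr mulrA invfM mulrCA mulfV ?gt_eqF// mulr1 => hh.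
  have := ler_wpM2l (ltW C0) cL; rewrite !mulrA => CL.
  by rewrite -!mulrA in CL hh *; exact: half_absorb hh CL.
have dGh : 'd G q0 h = 0 by rewrite -deriveE.
rewrite dGh subr0 in hG.
apply: le_trans hG _.
apply: le_trans (ler_wpM2l (ltW e'0) hle) _.
by rewrite mulrA divfK// gt_eqF// !mulr_gt0.
Qed.

End local_parametrization_facts.

(** The functions [unit_normal + k *: immersion] and [dotv n0 immersion], where
    [n0] is the normal at the point, have vanishing differentials there. *)
Lemma umbilic_normal_derive (S : oriented_surface R) (c : R -> 'rV[R]_3)
    (g : R -> S) (u : R) (dc : 'rV[R]_3) :
  continuous g -> (forall v, immersion (g v) = c v) -> is_derive u 1 c dc ->
  umbilic (g u) ->
  [/\ dotv (unit_normal (g u)) (unit_normal (g u)) = 1,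
      dotv (unit_normal (g u)) dc = 0 &
      exists k, is_derive u 1 (fun v => unit_normal (g v)) (- k *: dc)].
Proof.
move=> gc gE dcu [k [k' [[U [x [q0 [A [Ux Uq0 xq0 AE Apoly]]]]] kk']]].
rewrite -kk' in Apoly.
have dN := umbilic_jacobian Ux Uq0 AE Apoly.
pose F := @immersion R S \o x; pose nu := @unit_normal R S \o x.
have Fd : differentiable F q0 := param_differentiable Ux Uq0.
have Nd : differentiable nu q0 := param_normal_differentiable Ux Uq0.
have dcu' : is_derive u 1 (@immersion R S \o g) dc.
  by rewrite (_ : _ \o _ = c)//; apply/funext => v; exact: gE.
have dF h : is_derive q0 h F (h *m 'J F q0).
  by apply: DeriveDef; [exact: diff_derivable|exact: deriveEjacobian].
split.
- apply/enorm1; case: Ux => _ _ _ _ /(_ q0 Uq0)[+ _].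
  by rewrite xq0.
- pose n0 := unit_normal (g u).
  have d0 : is_derive u 1 (fun v => dotv n0 (c v)) 0.
    apply: (param_curve_derive0 Ux (G := fun q => dotv n0 (F q)) Uq0 xq0 (gc u) dcu').
    + have oU := param_open Ux; have Fk : Ck_on 1 U F by case: Ux.
      have [h _] := Ck_on_dotv oU (Ck_on_cst 1 U n0) Fk; exact: h.
    + move=> h; have [_ ->] := is_derive_dotv (is_derive_cst n0 q0 h) (dF h).
      rewrite dot0v add0r -(deriveEjacobian h Fd) /n0 -xq0.
      exact: (dotv_normal_derive Ux).
    + by move=> v q xq; rewrite /F /= xq gE.
  have [_ <-] := d0.
  have [_ ->] := is_derive_dotv (is_derive_cst n0 u 1) dcu.
  by rewrite dot0v add0r.
- exists k.
  have uoN : is_derive u 1 (fun v => unit_normal (g v) + k *: c v) 0.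
    apply: (param_curve_derive0 Ux (G := nu + k *: F) Uq0 xq0 (gc u) dcu').
    + by apply: differentiableD => //; exact: differentiableZ.
    + move=> h.
      have dNh : is_derive q0 h nu (h *m 'J nu q0).
        by apply: DeriveDef; [exact: diff_derivable|exact: deriveEjacobian].
      have [_ GE] := is_deriveD dNh (is_deriveZ k (dF h)).
      apply: etrans GE _.
      by rewrite dN -scalemxAr scaleNr addNr.
    + by move=> v q xq; rewrite /nu /F !fctE /= xq gE.
  have h := is_deriveB uoN (is_deriveZ k dcu).
  have -> : (fun v => unit_normal (g v)) =
      (fun v => unit_normal (g v) + k *: c v) - (k *: c).
    by apply/funext => v; rewrite fctE addrK.
  by apply: (is_derive_eq h); rewrite sub0r scaleNr.
Qed.

End umbilic_along.

Section necessity.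
Context {R : realType} (l : R) (c : R -> 'rV[R]_3).
Hypothesis l_gt0 : 0 < l.
Hypothesis c_closed : closed_smooth_curve l c.
Hypothesis c_arc_length : arc_length_parametrized c.
Hypothesis c_curved : forall u, curvature c u != 0.

Lemma umbilic_curve_total_torsion (S : oriented_surface R) :
  curve_of_umbilic_points S l c ->
  exists m : int,
    \int[lebesgue_measure]_(u in `[0, l]) torsion c u = 2 * pi * m%:~R.
Proof.
move=> [g [gc gl gE gumb]].
have along u := umbilic_normal_derive gc gE (is_derive_curve c_closed u) (gumb u).
have [lam lamE] := choice (fun u => let: And3 _ _ h := along u in h).
apply: (parallel_normal_total_torsion l_gt0 c_closed c_arc_length c_curved
  (nu := fun u => unit_normal (g u)) (lam := lam)) => //.
- by rewrite -[l in LHS]add0r gl.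
- by move=> u; have [] := along u.
- by move=> u; have [] := along u.
Qed.

End necessity.

(** * The surface swept by a parallel frame *)

Section swept_surface.
Context {R : realType} (l : R) (c t w nu : R -> 'rV[R]_3) (lam mu : R -> R).
Implicit Types (u : R) (q h : 'rV[R]_2).

Hypothesis fr : parallel_framing l c t w nu lam mu.

Local Notation pu q := (q 0 0).
Local Notation pv q := (q 0 1).

(** Along the axis [pv q = 0] this surface is tangent to [t] and [w]; the quadratic
    term gives the transverse curves the normal curvature [lam] of the axis. *)
Definition surf q : 'rV[R]_3 :=
  c (pu q) + pv q *: w (pu q) + (2^-1 * pv q ^+ 2 * lam (pu q)) *: nu (pu q).

(** [surf_alpha] and [surf_beta] are the components on [t] and [nu] of the
    derivative of [surf] along the axis direction, [surf_gamma] is the component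
    on [nu] of the transverse derivative. The surface is immersed where
    [surf_alpha] does not vanish. *)
Definition surf_alpha q : R :=
  1 - pv q * mu (pu q) - 2^-1 * pv q ^+ 2 * lam (pu q) ^+ 2.

Definition surf_beta q : R := 2^-1 * pv q ^+ 2 * 'D_1 lam (pu q).

Definition surf_gamma q : R := lam (pu q) * pv q.

Definition surf_u q : 'rV[R]_3 :=
  surf_alpha q *: t (pu q) + surf_beta q *: nu (pu q).

Definition surf_v q : 'rV[R]_3 := w (pu q) + surf_gamma q *: nu (pu q).

(** The cross product of [surf_u] and [surf_v] up to sign, in the frame. *)
Definition surf_cross q : 'rV[R]_3 :=
  (- surf_beta q) *: t (pu q) + (- (surf_gamma q * surf_alpha q)) *: w (pu q) +
  surf_alpha q *: nu (pu q).

Definition surf_area2 q : R :=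
  surf_beta q ^+ 2 + (surf_gamma q * surf_alpha q) ^+ 2 + surf_alpha q ^+ 2.

Definition surf_normal q : 'rV[R]_3 := rsqrt (surf_area2 q) *: surf_cross q.

Lemma surf_axis q : pv q = 0 -> surf q = c (pu q).
Proof.
by move=> v0; rewrite /surf v0 expr0n /= mulr0 mul0r !scale0r !addr0.
Qed.

Lemma dotv_surf_cross q : dotv (surf_cross q) (surf_cross q) = surf_area2 q.
Proof.
have [tt ww nn tw [tn wn]] := framing_orthonormal fr (pu q).
rewrite /surf_cross; move: (t _) (w _) (nu _) tt ww nn tw tn wn => a b d.
move=> aa bb dd ab ad bd.
rewrite !dotv_lin (dotvC b a) (dotvC d a) (dotvC d b) aa bb dd ab ad bd.
by rewrite /surf_area2; ring.
Qed.

Lemma surf_cross_perp q :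
  dotv (surf_u q) (surf_cross q) = 0 /\ dotv (surf_v q) (surf_cross q) = 0.
Proof.
have [tt ww nn tw [tn wn]] := framing_orthonormal fr (pu q).
rewrite /surf_cross /surf_u /surf_v.
move: (t _) (w _) (nu _) tt ww nn tw tn wn => a b d.
move=> aa bb dd ab ad bd.
by rewrite !dotv_lin (dotvC b a) (dotvC d a) (dotvC d b) aa bb dd ab ad bd;
  split; ring.
Qed.

Lemma surf_free q (x y : R) : surf_alpha q != 0 ->
  x *: surf_u q + y *: surf_v q = 0 -> x = 0 /\ y = 0.
Proof.
move=> a0 xy0; have [tt ww nn tw [tn wn]] := framing_orthonormal fr (pu q).
have xt : dotv (x *: surf_u q + y *: surf_v q) (t (pu q)) = x * surf_alpha q.
  rewrite /surf_u /surf_v; move: (t _) (w _) (nu _) tt ww nn tw tn wn => a b d.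
  move=> aa bb dd ab ad bd.
  by rewrite !dotv_lin (dotvC b a) (dotvC d a) aa ab ad; ring.
have yw : dotv (x *: surf_u q + y *: surf_v q) (w (pu q)) = y.
  rewrite /surf_u /surf_v; move: (t _) (w _) (nu _) tt ww nn tw tn wn => a b d.
  move=> aa bb dd ab ad bd.
  by rewrite !dotv_lin (dotvC d b) bb ab bd; ring.
rewrite xy0 dot0v in xt; rewrite xy0 dot0v in yw; split; last by [].
by move/esym/eqP: xt; rewrite mulf_eq0 (negbTE a0) orbF => /eqP.
Qed.

Lemma is_derive_proj q h i : is_derive q h (fun y : 'rV[R]_2 => y 0 i : R) (h 0 i).
Proof. by have /is_derive_rowP := is_derive_id q h; exact. Qed.

Lemma differentiable_proj q i : differentiable (fun y : 'rV[R]_2 => y 0 i : R) q.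
Proof. exact: differentiable_coord. Qed.

Lemma is_derive_along (W : normedModType R) (f : R -> W) (df : W) q h :
  is_derive (pu q) 1 f df -> is_derive q h (fun y => f (pu y)) (pu h *: df).
Proof.
move=> fd; have := is_derive_comp_real (differentiable_proj q 0) (is_derive_proj q h 0) fd.
exact.
Qed.

Lemma is_derive_sqr (f : 'rV[R]_2 -> R) q h (df : R) :
  is_derive q h f df -> is_derive q h (fun y => f y ^+ 2) (2 * f q * df).
Proof.
move=> fd; have := is_deriveM fd fd; rewrite (_ : f * f = fun y => f y ^+ 2).
  by move=> fd2; apply: (is_derive_eq fd2); rewrite /GRing.scale /=; ring.
by apply/funext => y; rewrite expr2.
Qed.

Lemma is_derive_half_sqr q h : is_derive q h
  (fun y : 'rV[R]_2 => 2^-1 * pv y ^+ 2) (pv q * pv h).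
Proof.
have d2 := is_derive_sqr (is_derive_proj q h 1).
have d3 := is_deriveZ (2^-1 : R) d2.
by apply: (is_derive_eq d3); rewrite /GRing.scale /=; field.
Qed.

Lemma is_derive_surf q h :
  is_derive q h surf (pu h *: surf_u q + pv h *: surf_v q).
Proof.
have dc := is_derive_along h (framing_curve fr (pu q)).
have dw := is_derive_along h (framing_conormal fr (pu q)).
have dnu := is_derive_along h (framing_normal fr (pu q)).
have dlam := is_derive_along h (smooth_derivable (pu q) (smooth_framing_lam fr)).
have dv := is_derive_proj q h 1.
have d1 := is_derive_scale dv dw.
have d2 := is_derive_scale (is_deriveM (is_derive_half_sqr q h) dlam) dnu.
have d3 := is_deriveD (is_deriveD dc d1) d2.
apply: (is_derive_eq d3).
rewrite /surf_u /surf_v /surf_alpha /surf_beta /surf_gamma.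
move: (t _) (w _) (nu _) ('D_1 lam _) => ? ? ? ?.
by apply/rowP => i; rewrite !mxE /GRing.scale /= ?fctE; ring.
Qed.

Lemma smooth_along n (f : R -> 'rV[R]_n) : smooth_on setT f ->
  smooth_on setT (fun q => f (pu q)).
Proof.
move=> fs k; apply: Ck_on_comp_row openT openT _ (fs k) _ => //.
exact: Ck_on_proj openT.
Qed.

Lemma smooth_along_real (f : R -> R) : smooth_on setT f ->
  smooth_on setT (fun q => f (pu q)).
Proof.
move=> fs k; apply: Ck_on_comp openT _ (fs k) _ => //.
exact: Ck_on_proj openT.
Qed.

Lemma smooth_half_sqr : smooth_on setT (fun q => 2^-1 * pv q ^+ 2).
Proof.
move=> k; have vk := @Ck_on_proj R 2 k setT 1 openT.
have := Ck_onM openT (@Ck_on_cst R 'rV[R]_2 R k setT (2^-1 : R)) (Ck_onM openT vk vk).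
by apply: (eq_Ck_on openT) => q _; rewrite expr2.
Qed.

Lemma smooth_surf : smooth_on setT surf.
Proof.
move=> k; apply: Ck_onD; [exact: openT| |].
  apply: Ck_onD; [exact: openT|exact: smooth_along (smooth_framing_curve fr) k|].
  apply: Ck_on_scale; [exact: openT|exact: Ck_on_proj openT|].
  exact: smooth_along (smooth_framing_conormal fr) k.
apply: Ck_on_scale; [exact: openT| |exact: smooth_along (smooth_framing_normal fr) k].
exact: Ck_onM openT (smooth_half_sqr k) (smooth_along_real (smooth_framing_lam fr) k).
Qed.

Lemma smooth_surf_alpha : smooth_on setT surf_alpha.
Proof.
move=> k; have lamk := smooth_along_real (smooth_framing_lam fr) k.
have muk := smooth_along_real (smooth_framing_mu fr) k.
have vk := @Ck_on_proj R 2 k setT 1 openT.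
have h1 := Ck_onB openT (@Ck_on_cst R 'rV[R]_2 R k setT (1 : R)) (Ck_onM openT vk muk).
have h2 := Ck_onB openT h1 (Ck_onM openT (smooth_half_sqr k) (Ck_onM openT lamk lamk)).
by move: h2; apply: (eq_Ck_on openT) => q _; rewrite /surf_alpha expr2.
Qed.

Lemma smooth_surf_beta : smooth_on setT surf_beta.
Proof.
move=> k; have lamk := smooth_along_real (smooth_onD1 (smooth_framing_lam fr)) k.
exact: Ck_onM openT (smooth_half_sqr k) lamk.
Qed.

Lemma smooth_surf_gamma : smooth_on setT surf_gamma.
Proof.
move=> k; have lamk := smooth_along_real (smooth_framing_lam fr) k.
exact: Ck_onM openT lamk (@Ck_on_proj R 2 k setT 1 openT).
Qed.

Lemma smooth_surf_area2 : smooth_on setT surf_area2.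
Proof.
move=> k; have ak := smooth_surf_alpha k; have bk := smooth_surf_beta k.
have gak := Ck_onM openT (smooth_surf_gamma k) ak.
have := Ck_onD openT (Ck_onD openT (Ck_onM openT bk bk) (Ck_onM openT gak gak))
  (Ck_onM openT ak ak).
by apply: (eq_Ck_on openT) => q _; rewrite /surf_area2 !expr2.
Qed.

Lemma smooth_surf_cross : smooth_on setT surf_cross.
Proof.
move=> k; have ak := smooth_surf_alpha k; have bk := smooth_surf_beta k.
have gak := Ck_onM openT (smooth_surf_gamma k) ak.
have tk := smooth_along (smooth_framing_tangent fr) k.
have wk := smooth_along (smooth_framing_conormal fr) k.
have nk := smooth_along (smooth_framing_normal fr) k.
apply: Ck_onD; [exact: openT| |exact: Ck_on_scale openT ak nk].
apply: Ck_onD; [exact: openT| |].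
  exact: Ck_on_scale openT (Ck_onN openT bk) tk.
exact: Ck_on_scale openT (Ck_onN openT gak) wk.
Qed.

Lemma surf_area2_gt0 q : surf_alpha q != 0 -> 0 < surf_area2 q.
Proof.
move=> a0; rewrite /surf_area2 ltr_wpDl//; first by rewrite addr_ge0// sqr_ge0.
by rewrite exprn_even_gt0.
Qed.

Lemma smooth_surf_normal (U : set 'rV[R]_2) : open U ->
  (forall q, U q -> surf_alpha q != 0) -> smooth_on U surf_normal.
Proof.
move=> oU Ua k; have UT : U `<=` setT by [].
apply: (Ck_on_scale oU); last exact: Ck_on_sub UT (smooth_surf_cross k).
apply: (Ck_on_comp oU _ (@smooth_on_rsqrt R k)
  (Ck_on_sub UT (smooth_surf_area2 k))) => q Uq.
exact/surf_area2_gt0/Ua.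
Qed.

Lemma surf_normal_unit q : surf_alpha q != 0 ->
  dotv (surf_normal q) (surf_normal q) = 1.
Proof.
move=> a0; rewrite /surf_normal dotvZl dotvZr dotv_surf_cross mulrA -expr2.
exact/sqr_rsqrt/surf_area2_gt0.
Qed.

Lemma surf_normal_perp q :
  dotv (surf_u q) (surf_normal q) = 0 /\ dotv (surf_v q) (surf_normal q) = 0.
Proof.
by have [h1 h2] := surf_cross_perp q; rewrite /surf_normal !dotvZr h1 h2 mulr0.
Qed.

(** On the axis the second fundamental form of the surface is [lam] times the
    first: this is what the quadratic term of [surf] is designed for. *)
Lemma is_derive_surf_normal_axis q h : pv q = 0 ->
  is_derive q h surf_normal
    (- lam (pu q) *: (pu h *: surf_u q + pv h *: surf_v q)).
Proof.
move=> v0.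
have dt := is_derive_along h (framing_tangent fr (pu q)).
have dw := is_derive_along h (framing_conormal fr (pu q)).
have dnu := is_derive_along h (framing_normal fr (pu q)).
have dlam := is_derive_along h (smooth_derivable (pu q) (smooth_framing_lam fr)).
have dlam' := is_derive_along h (smooth_derivable (pu q)
  (smooth_onD1 (smooth_framing_lam fr))).
have dmu := is_derive_along h (smooth_derivable (pu q) (smooth_framing_mu fr)).
have dv := is_derive_proj q h 1.
have dv2 := is_derive_half_sqr q h.
have a1 : surf_alpha q = 1 by rewrite /surf_alpha v0; ring.
have b0 : surf_beta q = 0 by rewrite /surf_beta v0; ring.
have g0 : surf_gamma q = 0 by rewrite /surf_gamma v0; ring.
have s1 : surf_area2 q = 1 by rewrite /surf_area2 a1 b0 g0; ring.
have r1 : rsqrt (surf_area2 q) = 1 by rewrite s1 /rsqrt sqrtr1 invr1.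
have da : is_derive q h surf_alpha (- (pv h * mu (pu q))).
  have d := is_deriveB (is_deriveB (is_derive_cst (1 : R) q h) (is_deriveM dv dmu))
    (is_deriveM dv2 (is_derive_sqr dlam)).
  by apply: (is_derive_eq d); rewrite /GRing.scale /= ?fctE ?v0 /=; ring.
have db : is_derive q h surf_beta 0.
  have d := is_deriveM dv2 dlam'.
  by apply: (is_derive_eq d); rewrite /GRing.scale /= ?fctE ?v0 /=; ring.
have dg : is_derive q h surf_gamma (lam (pu q) * pv h).
  have d := is_deriveM dlam dv.
  by apply: (is_derive_eq d); rewrite /GRing.scale /= ?fctE ?v0 /=; ring.
have dga : is_derive q h (fun y => surf_gamma y * surf_alpha y) (lam (pu q) * pv h).
  have d := is_deriveM dg da.
  by apply: (is_derive_eq d); rewrite /GRing.scale /= ?fctE a1 g0; ring.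
have ds : is_derive q h surf_area2 (- (2 * pv h * mu (pu q))).
  have d := is_deriveD (is_deriveD (is_derive_sqr db) (is_derive_sqr dga))
    (is_derive_sqr da).
  by apply: (is_derive_eq d); rewrite a1 b0 g0; ring.
have dr : is_derive q h (fun y => rsqrt (surf_area2 y)) (pv h * mu (pu q)).
  have sd : differentiable surf_area2 q by have [sd _] := smooth_surf_area2 1; exact: sd.
  have s0 : 0 < surf_area2 q by rewrite s1.
  have d := is_derive_comp_real sd ds (is_derive1_rsqrt s0).
  by apply: (is_derive_eq d); rewrite r1 /GRing.scale /=; field.
have dcross : is_derive q h surf_cross
    (- lam (pu q) *: (pu h *: surf_u q + pv h *: surf_v q) -
     (pv h * mu (pu q)) *: nu (pu q)).
  have d := is_deriveD (is_deriveD (is_derive_scale (is_deriveN db) dt)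
    (is_derive_scale (is_deriveN dga) dw)) (is_derive_scale da dnu).
  apply: (is_derive_eq d); rewrite /surf_u /surf_v a1 b0 g0.
  move: (t _) (w _) (nu _) => ? ? ?.
  by apply/rowP => i; rewrite !mxE /GRing.scale /= ?fctE a1 b0 g0; ring.
have d := is_derive_scale dr dcross.
apply: (is_derive_eq d); rewrite r1 scale1r.
have -> : surf_cross q = nu (pu q).
  by rewrite /surf_cross a1 b0 g0 mul0r oppr0 !scale0r scale1r !add0r.
by rewrite addrC subrK.
Qed.

End swept_surface.

(** * Topology of the cylinder *)

Section subspaces.

Lemma set_type_hausdorff (T : topologicalType) (A : set T) :
  hausdorff_space T -> hausdorff_space A.
Proof.
rewrite !open_hausdorff => hT x y xy.
have vxy : val x != val y by apply: contra_neq xy => /val_inj.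
have [[B C] /= [xB yC] [oB oC BC0]] := hT _ _ vxy.
exists (val @^-1` B, val @^-1` C) => /=.
  by split; rewrite inE; [move: xB|move: yC]; rewrite inE.
split; [by exists B|by exists C|].
by rewrite -preimage_setI (eqP BC0) preimage_set0.
Qed.

Lemma set_type_second_countable (T : topologicalType) (A : set T) :
  @second_countable T -> @second_countable A.
Proof.
move=> [B cB [Bo Bx]]; exists [set val @^-1` b | b in B].
  exact: card_le_trans (card_image_le _ _) cB.
split=> [_ [b Bb <-]|x]; first by exists b => //; exact: Bo.
move=> V; rewrite nbhsE => -[_ [[b ob <-] bx] bV].
have [c [Bc cx] cb] := Bx _ _ (open_nbhs_nbhs (conj ob bx)).
exists (val @^-1` c); first by split=> //; exists c.
by move=> y cy; apply: bV; exact: cb.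
Qed.

Lemma rV_second_countable (R : realType) n : @second_countable 'rV[R]_n.
Proof.
pose box (ab : {ffun 'I_n -> rat * rat}) :=
  [set p : 'rV[R]_n | forall i, ratr (ab i).1 < p 0 i < ratr (ab i).2].
exists (range box).
  exact: card_le_trans (card_image_le _ _) (countableP _).
split=> [_ [ab _ <-]|p].
  rewrite openE => p pab.
  apply: (@filter_forall _ _ (fun (i : 'I_n) (q : 'rV[R]_n) =>
    is_true (ratr (ab i).1 < q 0 i < ratr (ab i).2)) (nbhs p)) => i.
  have oI : open (`](ratr (ab i).1), (ratr (ab i).2)[%classic : set R).
    exact: itv_open.
  have pI : (`](ratr (ab i).1), (ratr (ab i).2)[%classic : set R) (p 0 i).
    by rewrite /= in_itv; exact: pab.
  have pnI : nbhs p (fun q : 'rV[R]_n =>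
      `](ratr (ab i).1), (ratr (ab i).2)[%classic (q 0 i)).
    exact: (@coord_continuous R 1 n 0 i p _ (open_nbhs_nbhs (conj oI pI))).
  by apply: (@filterS _ (nbhs p) _ _ _ _ pnI) => q; rewrite /= in_itv.
move=> V /nbhs_ballP[e /= e0 eV].
have rats i : exists ab : rat * rat,
    [/\ p 0 i - e < ratr ab.1 :> R, ratr ab.1 < p 0 i,
        p 0 i < ratr ab.2 & ratr ab.2 < p 0 i + e].
  have [a ] : exists q : rat, ratr q \in `](p 0 i - e), (p 0 i)[.
    by apply: rat_in_itvoo; rewrite ltrBlDr ltrDl.
  rewrite in_itv/= => /andP[a1 a2].
  have [b ] : exists q : rat, ratr q \in `](p 0 i), (p 0 i + e)[.
    by apply: rat_in_itvoo; rewrite ltrDl.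
  by rewrite in_itv/= => /andP[b1 b2]; exists (a, b).
have [ab abP] := choice rats.
exists (box [ffun i => ab i]).
  split; first by exists [ffun i => ab i].
  by move=> i; rewrite ffunE; have [_ -> -> _] := abP i.
move=> q qab; apply: eV; rewrite -ball_normE /= [ltLHS]/Num.Def.normr/= mx_normrE.
apply: bigmax_lt => // -[i j] _ /=; rewrite !mxE ord1.
have := qab j; rewrite ffunE => /andP[h1 h2]; have [h3 _ _ h4] := abP j.
by rewrite ltr_norml; apply/andP; split; lra.
Qed.

End subspaces.

Section cylinder.
Context {R : realType} (l : R).
Hypothesis l_gt0 : 0 < l.
Implicit Types (q : 'rV[R]_2) (d e : R).

Local Notation pu q := (q 0 0).
Local Notation pv q := (q 0 1).

Definition pt (u v : R) : 'rV[R]_2 := \row_(i < 2) (if i == 0 then u else v).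

Lemma ptE u v : (pu (pt u v) = u) * (pv (pt u v) = v).
Proof. by split; rewrite mxE. Qed.

Lemma row2P (T : Type) (p q : 'rV[T]_2) : pu p = pu q -> pv p = pv q -> p = q.
Proof.
move=> h0 h1; apply/rowP => -[[|[|//]]] i2.
  by rewrite (_ : Ordinal i2 = 0)//; exact/val_inj.
by rewrite (_ : Ordinal i2 = 1)//; exact/val_inj.
Qed.

(** The points of the plane that the covering of a cylinder of circumference [l]
    identifies. *)
Definition same_point q q' :=
  pv q' = pv q /\ exists k : int, pu q' = pu q + k%:~R * l.

Lemma same_point_sym q q' : same_point q q' -> same_point q' q.
Proof.
move=> [vE [k uE]]; split=> //; exists (- k).
by rewrite uE mulrNz mulNr addrK.
Qed.

Lemma same_point_trans q q' q'' :
  same_point q q' -> same_point q' q'' -> same_point q q''.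
Proof.
move=> [v1 [k1 u1]] [v2 [k2 u2]]; split; first by rewrite v2.
by exists (k1 + k2); rewrite u2 u1 intrD mulrDl addrA.
Qed.

Lemma same_point_reduce q : exists2 q', same_point q q' & 0 <= pu q' < l.
Proof.
have [m ml] := period_reduction l_gt0 (pu q).
exists (pt (pu q - m%:~R * l) (pv q)); rewrite /same_point ?ptE//.
by split => //; exists (- m); rewrite mulrNz mulNr.
Qed.

Lemma same_point_near q q' : same_point q q' -> `|pu q - pu q'| < l -> q = q'.
Proof.
move=> [vE [k uE]]; rewrite uE opprD addNKr normrN normrM (gtr0_norm l_gt0).
rewrite gtr_pMl// -intr_norm ltrz1 => k1.
have k0 : k = 0 by apply/eqP; rewrite -normr_le0 -ltzD1 add0r.
by apply: row2P; rewrite ?uE ?k0 ?mul0r ?addr0 ?vE.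
Qed.

Definition strip d := [set q : 'rV[R]_2 | `|pv q| < d].

Definition periodic_map (T : Type) (Phi : 'rV[R]_2 -> T) :=
  forall q q', same_point q q' -> Phi q = Phi q'.

Definition injective_mod (T : Type) (Phi : 'rV[R]_2 -> T) d :=
  forall q q', `|pv q| <= d -> `|pv q'| <= d -> Phi q = Phi q' -> same_point q q'.

Lemma continuous_pu : continuous (fun q => pu q).
Proof. exact: coord_continuous. Qed.

Lemma continuous_pv : continuous (fun q => pv q).
Proof. exact: coord_continuous. Qed.

Lemma open_strip d : open (strip d).
Proof.
rewrite (_ : strip d = (fun q => pv q) @^-1` `](- d), d[).
  by apply: open_comp; [move=> q _; exact: continuous_pv|exact: itv_open].
by apply/seteqP; split=> q; rewrite /strip /= in_itv/= ltr_norml.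
Qed.

(** The part of a closed period rectangle outside [A] is compact, so removing its
    image from the target leaves an open set; as the rectangle meets every class,
    this open set cuts out [A]. *)
Lemma saturated_open (T : topologicalType) (Phi : 'rV[R]_2 -> T) d
    (A : set 'rV[R]_2) : hausdorff_space T -> continuous Phi ->
  periodic_map Phi -> injective_mod Phi d -> open A ->
  (forall q q', same_point q q' -> A q -> A q') ->
  exists2 B : set T, open B & forall q, `|pv q| <= d -> (B (Phi q) <-> A q).
Proof.
move=> hT cPhi Phil Phi_inj oA sA.
pose K := [set q : 'rV[R]_2 | forall i : 'I_2,
  (if i == 0 then `[0, l]%classic else `[- d, d]%classic) (q 0 i)].
have cK : compact K.
  have := @rV_compact R 2
    (fun i => if i == 0 then `[0, l]%classic else `[- d, d]%classic).
  by apply=> i; case: ifP => _; exact: segment_compact.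
pose C := Phi @` (K `&` ~` A).
have cC : compact C.
  apply: continuous_compact; first exact: continuous_subspaceT.
  by apply: compact_closedI => //; exact: open_closedC.
have KP q : 0 <= pu q < l -> `|pv q| <= d -> K q.
  move=> /andP[u0 ul] vd i; case: ifP => [/eqP ->|i0].
    by rewrite /= in_itv/= u0 ltW.
  have -> : i = 1 by case: i i0 => -[|[|//]] i2 // _; exact/val_inj.
  by rewrite /= in_itv/= -ler_norml.
have Kv q : K q -> `|pv q| <= d.
  by move=> /(_ 1) /=; rewrite in_itv/= ler_norml.
exists (~` C); first by rewrite openC; exact: compact_closed.
move=> q qd; split=> [nC|Aq [q' [Kq' nA] /esym Phiq]].
  apply: contrapT => nA; apply: nC.
  have [q' qq' q'0] := same_point_reduce q.
  exists q'; last exact/esym/Phil.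
  split; first by apply: KP => //; case: qq' => ->.
  by apply: contra_not nA; apply: sA; exact: same_point_sym.
by apply: nA; apply: (sA q) => //; apply: Phi_inj => //; exact: Kv.
Qed.

Definition saturation (V : set 'rV[R]_2) :=
  [set q | exists2 q', V q' & same_point q' q].

Lemma saturation_same (V : set 'rV[R]_2) q q' :
  same_point q q' -> saturation V q -> saturation V q'.
Proof. by move=> qq' [p Vp pq]; exists p => //; exact: same_point_trans qq'. Qed.

Lemma open_saturation (V : set 'rV[R]_2) : open V -> open (saturation V).
Proof.
move=> oV; rewrite (_ : saturation V = \bigcup_(k : int)
    ((fun q => q + pt (k%:~R * l) 0) @^-1` V)); last first.
  apply/seteqP; split=> q.
    move=> [q' Vq' [vE [k uE]]]; exists (- k) => //=.
    suff -> : q + pt ((- k)%:~R * l) 0 = q' by [].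
    by apply: row2P; rewrite [LHS]mxE ptE ?uE ?vE ?addr0// mulrNz mulNr addrK.
  move=> [k _ /= Vq]; exists (q + pt (k%:~R * l) 0) => //.
  rewrite /same_point !mxE /= addr0; split => //; exists (- k).
  by rewrite mulrNz mulNr addrK.
apply: bigcup_open => k _; apply: open_comp => // q _.
by apply: differentiable_continuous; apply: differentiableD.
Qed.

(** The plane wrapped around the unit cylinder, a period [l] of the first
    coordinate making one turn. *)
Definition cyl_map q : 'rV[R]_3 := \row_(i < 3)
  (if i == 0 then cos (2 * pi / l * pu q)
   else if i == 1 then sin (2 * pi / l * pu q) else pv q).

Lemma cyl_mapE q :
  ((cyl_map q 0 0 = cos (2 * pi / l * pu q)) *
   (cyl_map q 0 1 = sin (2 * pi / l * pu q)) * (cyl_map q 0 2%:R = pv q))%type.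
Proof. by do !split; rewrite mxE. Qed.

Lemma continuous_cyl_map : continuous cyl_map.
Proof.
have linc q : {for q, continuous (fun q => 2 * pi / l * pu q)}.
  apply: (continuousM (s := cst (2 * pi / l)) (t := fun q => pu q)).
    exact: cst_continuous.
  exact: continuous_pu.
have oT := @openT 'rV[R]_2.
move=> q; apply: (@Ck_on_row _ _ _ 0 setT cyl_map oT) => // i {}q _.
elim/ord3P: i.
- rewrite (_ : (fun _ => _) = (fun q => cos (2 * pi / l * pu q))).
    by apply: (continuous_comp (linc q)); exact: continuous_cos.
  by apply/funext => p; rewrite cyl_mapE.
- rewrite (_ : (fun _ => _) = (fun q => sin (2 * pi / l * pu q))).
    by apply: (continuous_comp (linc q)); exact: continuous_sin.
  by apply/funext => p; rewrite cyl_mapE.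
- rewrite (_ : (fun _ => _) = (fun q => pv q)); first exact: continuous_pv.
  by apply/funext => p; rewrite cyl_mapE.
Qed.

Lemma periodic_cyl_map : periodic_map cyl_map.
Proof.
move=> q q' [vE [k uE]].
have E : 2 * pi / l * pu q' = 2 * pi / l * pu q + k%:~R * (pi *+ 2).
  by rewrite uE; field; rewrite gt_eqF.
by apply: row3P; rewrite !cyl_mapE ?vE// E;
  rewrite (periodic_int (@cosD2pi R)) || rewrite (periodic_int (@sinD2pi R)).
Qed.

Lemma injective_cyl_map d : injective_mod cyl_map d.
Proof.
move=> q q' _ _ qq'.
have C : cos (2 * pi / l * pu q) = cos (2 * pi / l * pu q').
  by have := congr1 (fun p : 'rV[R]_3 => p 0 0) qq'; rewrite !cyl_mapE.
have S : sin (2 * pi / l * pu q) = sin (2 * pi / l * pu q').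
  by have := congr1 (fun p : 'rV[R]_3 => p 0 1) qq'; rewrite !cyl_mapE.
split; first by have := congr1 (fun p : 'rV[R]_3 => p 0 2%:R) qq'; rewrite !cyl_mapE.
have : cos (2 * pi / l * pu q' - 2 * pi / l * pu q) = 1.
  by rewrite cosB C S -!expr2 cos2Dsin2.
move=> /cos_eq1[m]; rewrite -mulrBr => mE; exists m.
have unscale (p x y : R) : 0 < p -> 2 * p / l * x = 2 * p * y -> x = y * l.
  move=> p0 xy; transitivity (l / (2 * p) * (2 * p / l * x)).
    by field; rewrite (gt_eqF l_gt0) (gt_eqF p0).
  by rewrite xy; field; rewrite (gt_eqF p0).
have /eqP := unscale _ _ _ (pi_gt0 R) mE.
by rewrite subr_eq addrC => /eqP.
Qed.

End cylinder.

(** * The surface near its axis *)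

Section near_axis.
Context {R : realType} (l : R).
Hypothesis l_gt0 : 0 < l.
Implicit Types (q : 'rV[R]_2).

Local Notation pu q := (q 0 0).
Local Notation pv q := (q 0 1).
Local Notation same_point := (@same_point R l).

Lemma row2_norm_lt q (r : R) : 0 < r ->
  `|q| < r <-> `|pu q| < r /\ `|pv q| < r.
Proof.
move=> r0; rewrite [X in X < r]/Num.Def.normr/= mx_normrE; split=> [qr|[q0 q1]].
  split; apply: le_lt_trans qr.
    exact: (le_bigmax _ (fun i : 'I_1 * 'I_2 => `|q i.1 i.2|) (0, 0)).
  exact: (le_bigmax _ (fun i : 'I_1 * 'I_2 => `|q i.1 i.2|) (0, 1)).
apply: bigmax_lt => // -[i [[|[|//]] j2]] _ /=; rewrite ord1.
  by rewrite (_ : Ordinal j2 = 0)//; exact/val_inj.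
by rewrite (_ : Ordinal j2 = 1)//; exact/val_inj.
Qed.

Lemma ball_pt u0 v0 u v r : 0 < r -> `|u0 - u| < r -> `|v0 - v| < r ->
  ball (pt u0 v0 : 'rV[R]_2) r (pt u v).
Proof.
by move=> r0 ur vr; rewrite -ball_normE /=; apply/row2_norm_lt; rewrite ?mxE.
Qed.

Lemma pt_eta q : pt (pu q) (pv q) = q.
Proof. by apply: row2P; rewrite ptE. Qed.

(** The axis is compact modulo the period, so the neighbourhoods of its pairs of
    points can be given a uniform size. *)
Lemma near_axis_pair (P : 'rV[R]_2 -> 'rV[R]_2 -> Prop) :
  (forall p q p' q', same_point p p' -> same_point q q' -> P p q -> P p' q') ->
  (forall u u' : R, exists2 r : R, 0 < r & forall q q',
     ball (pt u 0) r q -> ball (pt u' 0) r q' -> P q q') ->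
  exists2 d, 0 < d & forall q q', `|pv q| <= d -> `|pv q'| <= d -> P q q'.
Proof.
move=> satP locP.
pose K := (`[0, l]%classic `*` `[0, l]%classic : set (R * R)).
have cK : compact K by apply: compact_setX; exact: segment_compact.
pose Q d (z : R * R) := forall v v', `|v| <= d -> `|v'| <= d ->
  P (pt z.1 v) (pt z.2 v').
have : \forall d \near (0 : R)^'+, K `<=` Q d.
  apply: (compact_near_coveringP K).1 => // -[u u'] _.
  have [r r0 hr] := locP u u'.
  exists (ball (u, u') r, [set d : R | d < r]) => /=.
    by split; [exact: nbhsx_ballx|exact: nbhs_right_lt].
  move=> [[u1 u1'] d] /= [[ur u'r] dr] v v' vd v'd.
  apply: hr; apply: ball_pt => //; rewrite ?sub0r ?normrN.
    exact: le_lt_trans vd dr.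
  exact: le_lt_trans v'd dr.
move=> hd; have [d [d0 KQ]] := filter_ex (filterI (nbhs_right_gt (0 : R)) hd).
exists d => // q q' qd q'd.
have [p qp /andP[p0 pl]] := same_point_reduce l_gt0 q.
have [p' qp' /andP[p'0 p'l]] := same_point_reduce l_gt0 q'.
apply: (satP p p' _ _ (same_point_sym qp) (same_point_sym qp')).
rewrite -(pt_eta p) -(pt_eta p'); apply: (KQ (pu p, pu p')) => /=.
- by split; rewrite /= in_itv/= ?p0 ?p'0 ltW.
- by case: qp => ->.
- by case: qp' => ->.
Qed.

Lemma near_axis_point (A : 'rV[R]_2 -> Prop) :
  (forall q q', same_point q q' -> A q -> A q') ->
  (forall u : R, nbhs (pt u 0) A) ->
  exists2 d, 0 < d & forall q, `|pv q| <= d -> A q.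
Proof.
move=> satA locA.
have [||d d0 hd] := @near_axis_pair (fun q _ => A q).
- by move=> p q p' q' pp' _; exact: satA.
- move=> u u'; have /nbhs_ballP[r /= r0 hr] := locA u.
  by exists r => // q q' qr _; exact: hr.
- by exists d => // q qd; exact: (hd q q).
Qed.

End near_axis.

Section surface_near_axis.
Context {R : realType} (l : R) (c t w nu : R -> 'rV[R]_3) (lam mu : R -> R).
Hypothesis l_gt0 : 0 < l.
Hypothesis fr : parallel_framing l c t w nu lam mu.
Implicit Types (q h : 'rV[R]_2).

Local Notation pu q := (q 0 0).
Local Notation pv q := (q 0 1).
Local Notation surf := (surf c w nu lam).
Local Notation alpha := (surf_alpha lam mu).
Local Notation surf_normal := (surf_normal t w nu lam mu).
Local Notation surf_u := (surf_u t nu lam mu).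
Local Notation surf_v := (surf_v w nu lam).

Lemma smooth_continuous (f : 'rV[R]_2 -> R) : smooth_on setT f -> continuous f.
Proof. by move=> fs q; exact: (fs 0%N). Qed.

Lemma periodic_surf : periodic_map l surf.
Proof.
move=> q q' [vE [k uE]]; have [cl _ wl nl [ll _]] := framing_periodic fr.
by rewrite /surf vE uE !(periodic_int cl, periodic_int wl, periodic_int nl, periodic_int ll).
Qed.

Lemma periodic_surf_alpha : periodic_map l alpha.
Proof.
move=> q q' [vE [k uE]]; have [_ _ _ _ [ll ml]] := framing_periodic fr.
by rewrite /surf_alpha vE uE !(periodic_int ml, periodic_int ll).
Qed.

Lemma periodic_surf_normal : periodic_map l surf_normal.
Proof.
move=> q q' qq'; have [vE [k uE]] := qq'.
have [_ tl wl nl [ll _]] := framing_periodic fr.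
have dll u : 'D_1 lam (u + l) = 'D_1 lam u by exact: periodic_derive.
have aE := periodic_surf_alpha qq'.
have bE : surf_beta lam q = surf_beta lam q'.
  by rewrite /surf_beta vE uE (periodic_int dll).
have gE : surf_gamma lam q = surf_gamma lam q'.
  by rewrite /surf_gamma vE uE (periodic_int ll).
rewrite /surf_normal /surf_area2 /surf_cross aE bE gE uE.
by rewrite !(periodic_int tl, periodic_int wl, periodic_int nl).
Qed.

(** [surf_alpha] is [1] on the axis. *)
Lemma strip_surf_alpha :
  exists2 d, 0 < d & forall q, `|pv q| <= d -> alpha q != 0.
Proof.
apply: (near_axis_point l_gt0) => [q q' /periodic_surf_alpha ->//|u].
have ac : continuous alpha by exact/smooth_continuous/(smooth_surf_alpha fr).
have a1 : alpha (pt u 0) = 1 by rewrite /surf_alpha !ptE; ring.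
have n1 : nbhs (alpha (pt u 0)) [set x : R | 0 < x].
  by apply: open_nbhs_nbhs; split; [exact: open_gt|rewrite a1 /= ltr01].
by apply: (@filterS _ (nbhs (pt u 0)) _ _ _ _ (ac (pt u 0) _ n1)) => q /lt0r_neq0.
Qed.

(** The form differs from [x ^+ 2 + y ^+ 2] by at most half of it. *)
Lemma near_identity_definite (a1 a2 b1 b2 x y : R) :
  `|a1 - 1| < 4^-1 -> `|a2 - 0| < 4^-1 -> `|b1 - 0| < 4^-1 ->
  `|b2 - 1| < 4^-1 ->
  x * (x * a1) + y * (x * a2) + (x * (y * b1) + y * (y * b2)) = 0 ->
  x = 0 /\ y = 0.
Proof.
have low (z a : R) : `|a| < 4^-1 -> - (4^-1 * `|z|) <= z * a.
  move=> a4; have := ler_norm (- (z * a)); rewrite normrN normrM.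
  have := ler_wpM2l (normr_ge0 z) (ltW a4); lra.
rewrite !subr0 => h1 h2 h3 h4.
have l1 := low (x ^+ 2) _ h1; have l2 := low (x * y) _ h2.
have l3 := low (x * y) _ h3; have l4 := low (y ^+ 2) _ h4.
rewrite !ger0_norm ?sqr_ge0// in l1 l4.
have xy : `|x * y| <= 2^-1 * (x ^+ 2 + y ^+ 2).
  by rewrite ler_norml; apply/andP; split;
    [have := sqr_ge0 (x + y)|have := sqr_ge0 (x - y)]; nra.
move=> q0; have s0 : x ^+ 2 + y ^+ 2 <= 0 by move: l1 l2 l3 l4 xy q0; lra.
have x0 := sqr_ge0 x; have y0 := sqr_ge0 y.
by split; apply/eqP; rewrite -sqrf_eq0 eq_le ?x0 ?y0 andbT; lra.
Qed.

(** For [h = q - q'] the derivative of [surf] along the segment from [q'] to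
    [q], paired with [h 0 0 *: t u + h 0 1 *: w u], is a quadratic form in [h]
    close to the square norm, so [surf] separates [q] from [q']. *)
Lemma surf_locally_injective (u : R) : exists2 r : R, 0 < r &
  forall q q', ball (pt u 0) r q -> ball (pt u 0) r q' -> surf q = surf q' -> q = q'.
Proof.
pose q0 : 'rV[R]_2 := pt u 0.
have [tt ww _ tw _] := framing_orthonormal fr u.
have oT := @openT 'rV[R]_2.
have tk := smooth_along (smooth_framing_tangent fr).
have wk := smooth_along (smooth_framing_conormal fr).
have nk := smooth_along (smooth_framing_normal fr).
have Suk : smooth_on setT surf_u.
  move=> k; apply: Ck_onD => //.
    exact: Ck_on_scale oT (smooth_surf_alpha fr k) (tk k).
  exact: Ck_on_scale oT (smooth_surf_beta fr k) (nk k).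
have Svk : smooth_on setT surf_v.
  move=> k; apply: Ck_onD => //.
  exact: Ck_on_scale oT (smooth_surf_gamma fr k) (nk k).
have near_dot (f : 'rV[R]_2 -> 'rV[R]_3) (e : 'rV[R]_3) (x : R) :
    smooth_on setT f -> dotv (f q0) e = x ->
    nbhs q0 (fun q => `|dotv (f q) e - x| < 4^-1).
  move=> fk fx; have gk := Ck_on_dotv oT (fk 0%N) (Ck_on_cst 0 setT e).
  have /cvgrPdist_lt/(_ 4^-1) := gk q0 I.
  rewrite invr_gt0 ltr0n => /(_ isT).
  apply: (@filterS _ (nbhs q0)) => q /=.
  by rewrite distrC fx.
have Su0 : surf_u q0 = t u.
  by rewrite /surf_u /surf_alpha /surf_beta !ptE expr0n /= !(mulr0, mul0r, subr0)
    scale1r scale0r addr0.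
have Sv0 : surf_v q0 = w u.
  by rewrite /surf_v /surf_gamma !ptE mulr0 scale0r addr0.
have n1 := near_dot surf_u (t u) 1 Suk (etrans (congr1 (fun x => dotv x _) Su0) tt).
have n2 := near_dot surf_u (w u) 0 Suk (etrans (congr1 (fun x => dotv x _) Su0) tw).
have n3 := near_dot surf_v (w u) 1 Svk (etrans (congr1 (fun x => dotv x _) Sv0) ww).
have n4 := near_dot surf_v (t u) 0 Svk
  (etrans (congr1 (fun x => dotv x _) Sv0) (etrans (dotvC _ _) tw)).
have /nbhs_ballP[r /= r0 hr] : nbhs q0 (fun q =>
    (`|dotv (surf_u q) (t u) - 1| < 4^-1 /\ `|dotv (surf_u q) (w u) - 0| < 4^-1) /\
    (`|dotv (surf_v q) (w u) - 1| < 4^-1 /\ `|dotv (surf_v q) (t u) - 0| < 4^-1)).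
  exact: filterI (filterI n1 n2) (filterI n3 n4).
exists r => // q q' qr q'r surfE.
pose h := q - q'; pose e := pu h *: t u + pv h *: w u.
pose f y := dotv (surf y) e.
have df y v : is_derive y v f
    (dotv (pu v *: surf_u y + pv v *: surf_v y) e).
  have d := is_derive_dotv (is_derive_surf fr y v) (is_derive_cst e y v).
  by apply: (is_derive_eq d); rewrite dotv0 addr0.
have fdiff y : differentiable f y.
  have [fd _] := Ck_on_dotv oT (smooth_surf fr 1) (Ck_on_cst 1 setT e).
  exact: fd.
have dline (s : R) := is_derive_line (a := h) (q := q') (fdiff (s *: h + q')).
have cline : {within `[0, 1], continuous (fun s : R => f (s *: h + q'))}.
  apply: continuous_subspaceT => s; apply: differentiable_continuous.
  by have [d _] := dline s; exact/derivable1_diffP.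
have [s s01 fE] := MVT ltr01 (fun s _ => dline s) cline.
have ball_s : ball (pt u 0 : 'rV[R]_2) r (s *: h + q').
  move: s01; rewrite in_itv/= => /andP[s0 s1].
  move: qr q'r; rewrite -ball_normE /= => qr q'r.
  have s1' : 0 < 1 - s by rewrite subr_gt0.
  have -> : pt u 0 - (s *: h + q') = s *: (pt u 0 - q) + (1 - s) *: (pt u 0 - q').
    by apply/rowP => i; rewrite !mxE; ring.
  apply: le_lt_trans (ler_normD _ _) _; rewrite !normrZ !gtr0_norm//.
  rewrite [ltRHS](_ : r = s * r + (1 - s) * r); last by ring.
  by apply: ltrD; rewrite ltr_pM2l.
have [[/= b1 b2] [/= b3 b4]] := hr _ ball_s.
have [_ dfE] := df (s *: h + q') h.
rewrite scale1r scale0r add0r /h subrK /f surfE subrr -/h subr0 mulr1 in fE.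
have {fE dfE} := etrans fE dfE.
move: (surf_u _) (surf_v _) b1 b2 b3 b4 => a b b1 b2 b3 b4.
rewrite /e !dotv_lin => /esym/(near_identity_definite b1 b2 b4 b3)[h0 h1].
apply/eqP; rewrite -subr_eq0 -/h; apply/eqP.
by apply: row2P; rewrite ?h0 ?h1 mxE.
Qed.

(** Axis points with distinct images have neighbourhoods with disjoint images.
    Those with the same image agree modulo the period, as [c] is simple, and
    then local injectivity applies after a translation. *)
Lemma strip_surf_injective :
  (forall u u', 0 <= u < l -> 0 <= u' < l -> c u = c u' -> u = u') ->
  exists2 d, 0 < d & injective_mod l surf d.
Proof.
move=> csimple.
pose P q q' := surf q = surf q' -> same_point l q q'.
apply: (near_axis_pair l_gt0 (P := P)) => [p q p' q' pp' qq' Ppq surfE|u u'].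
  have := Ppq; rewrite /P (periodic_surf pp') (periodic_surf qq') => /(_ surfE) pq.
  exact: same_point_trans (same_point_sym pp') (same_point_trans pq qq').
have surfc : continuous surf by move=> q; exact: (smooth_surf fr 0%N).
have axis v : surf (pt v 0) = c v by rewrite surf_axis ptE.
have [cuu'|cuu'] := eqVneq (c u) (c u'); last first.
  have := @norm_hausdorff _ 'rV[R]_3; rewrite open_hausdorff.
  move=> /(_ _ _ cuu')[[A B] /= [uA u'B] [oA oB AB0]].
  rewrite !inE /= in uA u'B.
  have nA : nbhs (surf (pt u 0)) A by rewrite axis; exact: open_nbhs_nbhs.
  have nB : nbhs (surf (pt u' 0)) B by rewrite axis; exact: open_nbhs_nbhs.
  have /nbhs_ballP[r1 /= r10 h1] := surfc _ _ nA.
  have /nbhs_ballP[r2 /= r20 h2] := surfc _ _ nB.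
  exists (Num.min r1 r2) => [|q q' qr q'r surfE]; first by rewrite lt_min r10.
  have qA : A (surf q) by apply: h1; apply: le_ball qr; rewrite ge_min lexx.
  have q'B : B (surf q') by apply: h2; apply: le_ball q'r; rewrite ge_min lexx orbT.
  suff : (A `&` B) (surf q) by rewrite (eqP AB0).
  by split=> //; rewrite surfE.
have [k uk] : exists k : int, u' = u + k%:~R * l.
  have [cl _ _ _ _] := framing_periodic fr.
  have [m m0] := period_reduction l_gt0 u; have [m' m'0] := period_reduction l_gt0 u'.
  have E v (j : int) : c (v - j%:~R * l) = c v.
    by rewrite -mulNr -mulrNz (periodic_int cl).
  have := csimple _ _ m0 m'0; rewrite !E => /(_ cuu') h.
  exists (m' - m); rewrite intrB mulrBl.
  by rewrite addrCA h addrCA subrr addr0.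
have [r r0 rinj] := surf_locally_injective u.
exists r => // q q' qr q'r surfE.
pose q'' := pt (pu q' - k%:~R * l) (pv q').
have q''q' : same_point l q'' q' by split; [rewrite ptE|exists k; rewrite ptE subrK].
suff -> : q = q'' by [].
apply: rinj => //; last by rewrite surfE (periodic_surf q''q').
have [h1 h2] : `|u' - pu q'| < r /\ `|0 - pv q'| < r.
  have : `|pt u' 0 - q'| < r by move: q'r; rewrite -ball_normE.
  by move=> /row2_norm_lt-/(_ r0); rewrite !mxE.
by apply: ball_pt => //; rewrite (_ : u - _ = u' - pu q')// uk; ring.
Qed.

End surface_near_axis.

(** * The umbilic cylinder *)

Section tube.
Context {R : realType} (l : R) (c t w nu : R -> 'rV[R]_3) (lam mu : R -> R).
Hypothesis l_gt0 : 0 < l.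
Hypothesis fr : parallel_framing l c t w nu lam mu.
Context (e : R).
Hypothesis e_gt0 : 0 < e.
Hypothesis e_alpha : forall q, strip e q -> surf_alpha lam mu q != 0.
Implicit Types (q : 'rV[R]_2).

Local Notation pu q := (q 0 0).
Local Notation pv q := (q 0 1).
Local Notation surf := (surf c w nu lam).
Local Notation surf_normal := (surf_normal t w nu lam mu).
Local Notation surf_u := (surf_u t nu lam mu).
Local Notation surf_v := (surf_v w nu lam).

(** The underlying surface: an open cylinder with the topology induced by
    three-space, mapped by [surf] with possible self-intersections. *)
Definition cylinder : set 'rV[R]_3 := cyl_map l @` strip e.

Lemma strip_axis (u : R) : strip e (pt u 0 : 'rV[R]_2).
Proof. by rewrite /strip /= ptE normr0. Qed.

Lemma cyl_map_in q : strip e q -> cyl_map l q \in cylinder.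
Proof. by move=> qe; apply/mem_set; exists q. Qed.

Definition proj q : cylinder :=
  insubd (exist (fun p => p \in cylinder) _ (cyl_map_in (strip_axis 0)) : cylinder)
    (cyl_map l q).

Lemma val_proj q : strip e q -> val (proj q) = cyl_map l q.
Proof. by move=> qe; rewrite insubdK//; exact: cyl_map_in. Qed.

Lemma repP (m : cylinder) : exists q, strip e q /\ cyl_map l q = val m.
Proof. by have [q qe qm] := set_mem (valP m); exists q. Qed.

Definition rep (m : cylinder) : 'rV[R]_2 := sval (cid (repP m)).

Lemma strip_rep m : strip e (rep m).
Proof. by rewrite /rep; case: cid => q []. Qed.

Lemma val_rep m : val m = cyl_map l (rep m).
Proof. by rewrite /rep; case: cid => q []. Qed.

Lemma repK m : proj (rep m) = m.
Proof. by apply: val_inj; rewrite val_proj ?val_rep//; exact: strip_rep. Qed.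

Lemma proj_same q q' : same_point l q q' -> proj q = proj q'.
Proof. by move=> qq'; rewrite /proj (periodic_cyl_map l_gt0 qq'). Qed.

Lemma rep_proj q : strip e q -> same_point l (rep (proj q)) q.
Proof.
move=> qe; apply: (injective_cyl_map l_gt0 (d := e)).
- exact: ltW (strip_rep _).
- exact: ltW.
- by rewrite -val_rep val_proj.
Qed.

Definition tube_map (m : cylinder) : 'rV[R]_3 := surf (rep m).
Definition tube_normal (m : cylinder) : 'rV[R]_3 := surf_normal (rep m).

Lemma tube_map_proj q : strip e q -> tube_map (proj q) = surf q.
Proof. by move=> qe; exact/(periodic_surf fr)/rep_proj. Qed.

Lemma tube_normal_proj q : strip e q -> tube_normal (proj q) = surf_normal q.
Proof. by move=> qe; exact/(periodic_surf_normal fr)/rep_proj. Qed.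

Lemma proj_continuous q : strip e q -> {for q, continuous proj}.
Proof.
move=> qe A; rewrite nbhsE => -[_ [[B oB <-] Bq] BA].
have nB : nbhs (cyl_map l q) B.
  by apply: open_nbhs_nbhs; split=> //; rewrite -val_proj.
have nq : nbhs q (strip e) by apply: open_nbhs_nbhs; split=> //; exact: open_strip.
have nB' : nbhs q (fun p => B (cyl_map l p)) by exact: (@continuous_cyl_map R l q).
suff : nbhs q (fun p => A (proj p)) by [].
apply: (@filterS2 _ (nbhs q) _ _ _ _ _ nq nB') => p pe Bp.
by apply: BA; suff : B (val (proj p)) by []; rewrite val_proj.
Qed.

(** The wrapping is injective modulo the period on the closed strip, so that the
    open saturated set generated by [V] is cut out by an open set of
    three-space. *)
Lemma proj_open (V : set 'rV[R]_2) : open V -> V `<=` strip e -> open (proj @` V).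
Proof.
move=> oV Ve.
have [B oB BE] := saturated_open l_gt0 (@norm_hausdorff _ _)
  (@continuous_cyl_map R l) (periodic_cyl_map l_gt0)
  (injective_cyl_map l_gt0 (d := e)) (open_saturation oV)
  (@saturation_same _ l V).
exists B => //; apply/seteqP; split=> m.
  move=> Bm; have : B (val m) by []; rewrite val_rep.
  move=> /(BE _ (ltW (strip_rep m))).1[q Vq qm].
  by exists q => //; rewrite (proj_same qm) repK.
move=> [q Vq <-]; suff : B (val (proj q)) by [].
rewrite val_proj; last exact: Ve.
apply/(BE _ (ltW (Ve _ Vq))).2; exists q => //.
by split=> //; exists 0; rewrite mul0r addr0.
Qed.

(** One period wide, so that [proj] is injective on it. *)
Definition chart_domain (u0 : R) : set 'rV[R]_2 :=
  [set q : 'rV[R]_2 | `|pu q - u0| < l / 2 /\ strip e q].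

Lemma open_chart_domain u0 : open (chart_domain u0).
Proof.
pose I := (fun q : 'rV[R]_2 => q 0 0) @^-1` `](u0 - l / 2), (u0 + l / 2)[.
have oI : open I.
  by apply: open_comp; [move=> q _; exact: continuous_pu|exact: itv_open].
rewrite (_ : chart_domain u0 = I `&` strip e); first (apply: openI; [exact: oI | exact: open_strip]).
by apply/seteqP; split=> q [h1 h2]; split=> //; move: h1;
  rewrite /I /preimage /= in_itv/= ltr_distl.
Qed.

Lemma near_chart u0 q (W : Type) (f g : 'rV[R]_2 -> W) :
  (forall p, strip e p -> f p = g p) -> chart_domain u0 q ->
  \forall p \near q, f p = g p.
Proof.
move=> fg qU; have nU := open_nbhs_nbhs (conj (@open_chart_domain u0) qU).
by apply: (@filterS _ (nbhs q) _ _ _ _ nU) => p [_ pe]; exact: fg.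
Qed.

Lemma smooth_tube_map u0 : smooth_on (chart_domain u0) (tube_map \o proj).
Proof.
move=> k; have : Ck_on k (chart_domain u0) surf.
  by apply: Ck_on_sub (smooth_surf fr k).
by apply: eq_Ck_on => [|q [_ qe]]; [exact: open_chart_domain|rewrite /= tube_map_proj].
Qed.

Lemma smooth_tube_normal u0 : smooth_on (chart_domain u0) (tube_normal \o proj).
Proof.
move=> k; have : Ck_on k (chart_domain u0) surf_normal.
  apply: (smooth_surf_normal fr) => [|q [_ qe]]; first exact: open_chart_domain.
  exact: e_alpha.
by apply: eq_Ck_on => [|q [_ qe]]; [exact: open_chart_domain|rewrite /= tube_normal_proj].
Qed.

Lemma mul_jacobian_tube_map u0 q (v : 'rV[R]_2) : chart_domain u0 q ->
  v *m 'J (tube_map \o proj) q = pu v *: surf_u q + pv v *: surf_v q.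
Proof.
move=> qU; have fd : differentiable (tube_map \o proj) q.
  by have [h _] := smooth_tube_map u0 1; exact: h.
have [_ sE] := is_derive_surf fr q v.
apply: etrans (esym (deriveEjacobian v fd)) (etrans _ sE).
by apply: near_eq_derive; exact: (near_chart tube_map_proj qU).
Qed.

Lemma mul_jacobian_tube_normal u0 q (v : 'rV[R]_2) : chart_domain u0 q ->
  pv q = 0 -> v *m 'J (tube_normal \o proj) q =
  - lam (pu q) *: (pu v *: surf_u q + pv v *: surf_v q).
Proof.
move=> qU q0; have fd : differentiable (tube_normal \o proj) q.
  by have [h _] := smooth_tube_normal u0 1; exact: h.
have [_ sE] := is_derive_surf_normal_axis fr v q0.
apply: etrans (esym (deriveEjacobian v fd)) (etrans _ sE).
by apply: near_eq_derive; exact: (near_chart tube_normal_proj qU).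
Qed.

Lemma chart_parametrization u0 :
  local_parametrization tube_map tube_normal (chart_domain u0) proj.
Proof.
split.
- split.
  + exact: open_chart_domain.
  + by move=> q [_ qe]; exact: proj_continuous.
  + move=> p q [pu0 pe] [qu0 qe] pq; apply: (same_point_near l_gt0).
      have := rep_proj pe; rewrite pq => /same_point_sym h.
      exact: same_point_trans h (rep_proj qe).
    rewrite -(subrKA u0) (splitr l).
    by apply: le_lt_trans (ler_normD _ _) _; rewrite ltrD// distrC.
  + by move=> V oV VU; apply: proj_open => // q /VU[].
- exact: smooth_tube_map.
- move=> q qU; rewrite -kermx_eq0; apply/rowV0P => v /sub_kermxP.
  rewrite (mul_jacobian_tube_map v qU) => v0.
  have [v00 v01] := surf_free fr (e_alpha qU.2) v0.
  by apply: row2P; rewrite ?v00 ?v01 mxE.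
- exact: smooth_tube_normal.
- move=> q qU; rewrite tube_normal_proj; last exact: qU.2.
  split; first by apply/enorm1; exact: (surf_normal_unit fr (e_alpha qU.2)).
  apply/row_matrixP => i; rewrite row0 rowE mulmxA.
  rewrite (mul_jacobian_tube_map _ qU) mulmx_trE.
  have [un vn] := surf_normal_perp fr q.
  rewrite dotvDl !dotvZl un vn !mulr0 addr0.
  by rewrite raddf0.
Qed.

Lemma tube_parametrized (m : cylinder) : exists U x,
  local_parametrization tube_map tube_normal U x /\ (x @` U) m.
Proof.
exists (chart_domain (pu (rep m))), proj; split; first exact: chart_parametrization.
exists (rep m); last exact: repK.
by split; [rewrite subrr normr0 divr_gt0|exact: strip_rep].
Qed.

Definition tube : oriented_surface R :=
  @OrientedSurface R cylinder tube_map tube_normal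
    (@set_type_hausdorff _ cylinder (@norm_hausdorff _ _))
    (@set_type_second_countable _ cylinder (@rV_second_countable R 3))
    tube_parametrized.

Lemma char_poly_scalar (k : R) :
  char_poly (k%:M : 'M[R]_2) = ('X - k%:P) * ('X - k%:P).
Proof.
by rewrite /char_poly /char_poly_mx map_scalar_mx -raddfB /= det_scalar expr2.
Qed.

Lemma umbilic_axis u : umbilic (proj (pt u 0) : tube).
Proof.
exists (lam u), (lam u); split=> //.
set m := proj (pt u 0); set q := rep m.
have [v0 [k uk]] := rep_proj (strip_axis u).
rewrite -/m -/q !ptE in v0 uk.
have qU : chart_domain (pu q) q.
  by split; [rewrite subrr normr0 divr_gt0|exact: strip_rep].
exists (chart_domain (pu q)), proj, q, (lam u)%:M; split.
- exact: chart_parametrization.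
- exact: qU.
- exact: repK.
- have [_ _ _ _ [ll _]] := framing_periodic fr.
  apply/row_matrixP => i; rewrite mul_scalar_mx !rowE mulmxN -scalemxAr.
  have nE := mul_jacobian_tube_normal (delta_mx 0 i) qU (esym v0).
  have mE := mul_jacobian_tube_map (delta_mx 0 i) qU.
  apply: etrans (congr1 -%R nE) (etrans _ (esym (congr1 ( *:%R (lam u)) mE))).
  by rewrite uk (periodic_int ll) scaleNr opprK.
- exact: char_poly_scalar.
Qed.

Lemma tube_umbilic_curve : curve_of_umbilic_points tube l c.
Proof.
exists (fun u => proj (pt u 0) : tube); split.
- move=> u; apply: (@continuous_comp _ _ _ (fun u => pt u 0) proj).
    apply: (@Ck_on_row _ R _ 0 setT (fun u => pt u 0) openT) => // i v _.
    case: (eqVneq i 0) => [->|i0].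
      rewrite (_ : (fun _ => _) = id); first exact: cvg_id.
      by apply/funext => z; rewrite ptE.
    rewrite (_ : (fun _ => _) = cst 0); first exact: cvg_cst.
    by apply/funext => z; rewrite mxE (negbTE i0).
  exact/proj_continuous/strip_axis.
- move=> u; apply: proj_same; apply: same_point_sym; split; first by rewrite !ptE.
  by exists 1; rewrite !ptE mul1r.
- by move=> u; rewrite /immersion /= tube_map_proj ?surf_axis ?ptE//; exact: strip_axis.
- exact: umbilic_axis.
Qed.

(** The same compactness argument as for the charts, applied to [surf] in place
    of the wrapping. *)
Lemma tube_embedded : injective_mod l surf e -> embedded tube.
Proof.
move=> surf_inj; split=> [m m' mm'|A oA].
  rewrite -[m]repK -[m']repK; apply: proj_same; apply: surf_inj => //.
    exact: ltW (strip_rep m).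
  exact: ltW (strip_rep m').
pose A' := strip e `&` proj @^-1` A.
have oA' : open A'.
  rewrite openE => q [qe Aq]; rewrite /interior; apply: filterI.
    by apply: open_nbhs_nbhs; split=> //; exact: open_strip.
  by apply: (proj_continuous qe); exact: open_nbhs_nbhs.
have sA' q q' : same_point l q q' -> A' q -> A' q'.
  move=> qq' [qe Aq]; split; last by rewrite /preimage /= -(proj_same qq').
  by case: qq' => vE _; rewrite /strip /= vE.
have surfc : continuous surf by move=> q; exact: (smooth_surf fr 0%N).
have [B oB BE] := saturated_open l_gt0 (@norm_hausdorff _ _) surfc (periodic_surf fr) surf_inj oA' sA'.
exists B => //; apply/seteqP; split=> m.
  move=> Am; apply/(BE _ (ltW (strip_rep m))).2; split; first exact: strip_rep.
  by rewrite /preimage /= repK.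
by move=> /(BE _ (ltW (strip_rep m))).1[_]; rewrite /preimage /= repK.
Qed.

End tube.

(** * Closed curves of umbilic points *)

Theorem proposition5 (R : realType) (l : R) (c : R -> 'rV[R]_3)
    (l_gt0 : 0 < l)
    (c_closed : closed_smooth_curve l c)
    (c_arc_length : arc_length_parametrized c)
    (c_curved : forall u, curvature c u != 0) :
  ((exists S : oriented_surface R, curve_of_umbilic_points S l c) <->
   (exists m : int,
      \int[lebesgue_measure]_(u in `[0, l]) torsion c u = 2 * pi * m%:~R)) /\
  (simple_curve l c ->
   ((exists S : oriented_surface R,
       embedded S /\ curve_of_umbilic_points S l c) <->
    (exists m : int,
       \int[lebesgue_measure]_(u in `[0, l]) torsion c u = 2 * pi * m%:~R))).
Proof.
have necessity S := @umbilic_curve_total_torsion R l c l_gt0 c_closed c_arc_length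
  c_curved S.
have framing m := @exists_parallel_framing R l c l_gt0 c_closed c_arc_length
  c_curved m.
split=> [|c_simple]; split=> [[S]|[m /framing[w [nu [lam [mu fr]]]]]].
- exact: necessity.
- have [d d0 d_alpha] := strip_surf_alpha l_gt0 fr.
  have d_alpha' q : strip d q -> surf_alpha lam mu q != 0.
    by move=> /ltW; exact: d_alpha.
  exists (tube l_gt0 fr d0 d_alpha'); exact: tube_umbilic_curve.
- by move=> [_]; exact: necessity.
- have [d d0 d_alpha] := strip_surf_alpha l_gt0 fr.
  have [d' d'0 d'_inj] := strip_surf_injective l_gt0 fr c_simple.
  pose e := Num.min d d'.
  have e0 : 0 < e by rewrite lt_min d0.
  have e_alpha q : strip e q -> surf_alpha lam mu q != 0.
    by move=> /ltW qe; apply: d_alpha; apply: le_trans qe _; rewrite ge_min lexx.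
  exists (tube l_gt0 fr e0 e_alpha); split; last exact: tube_umbilic_curve.
  apply: tube_embedded => q q' qe q'e; apply: d'_inj.
    by apply: le_trans qe _; rewrite ge_min lexx orbT.
  by apply: le_trans q'e _; rewrite ge_min lexx orbT.
Qed.
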